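(* Let $\Gamma=(V,E,s,t)$ be a multiquiver and $\gamma\in\operatorname{Hom}_{\mathbb{Z}}(\mathbb{Z}V,\mathbb{Z}E)$ its incidence matrix. There exists a map of $R_E$-rings with involution $$\varphi_\Gamma:\mathcal{A}(\Gamma)\longrightarrow A_E(\Bbbk),$$ uniquely determined by $$\varphi_\Gamma(X_v)=z^{\gamma(v)},\quad \varphi_\Gamma(Y_v)=z^{-\gamma(v)}\quad (v\in V),\qquad \varphi_\Gamma(u_e)=y_ex_e\quad(e\in E).$$
   Context: $\Bbbk$ is a field of characteristic zero; rings are associative and unital; $\mathbb{Z}X$ denotes the free abelian group on a set $X$. TGW algebras. A TGW datum $(R,\sigma,t)$ with index set $I$: a $\Bbbk$-algebra $R$, commuting $\Bbbk$-algebra automorphisms $\sigma=(\sigma_i)_{i\in I}$ of $R$, nonzero central elements $t=(t_i)_{i\in I}$ of $R$. Given $\mu=(\mu_{ij})_{i\ne j}$ with $\mu_{ij}\in\Bbbk\setminus\{0\}$, $\mathcal{C}_\mu(R,\sigma,t)$ is the free $R$-ring on symbols $X_i,Y_i$ ($i\in I$) modulo the relations $X_ir=\sigma_i(r)X_i$, $Y_ir=\sigma_i^{-1}(r)Y_i$, $Y_iX_i=t_i$, $X_iY_i=\sigma_i(t_i)$ ($r\in R$, $i\in I$), $X_iY_j=\mu_{ij}Y_jX_i$ ($i\neq j$). It is $\mathbb{Z}I$-graded by $\deg X_i=i$, $\deg Y_i=-i$, $\deg r=0$. The TGW algebra $\mathcal{A}_\mu(R,\sigma,t)$ is the quotient of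 $\mathcal{C}_\mu(R,\sigma,t)$ by the sum of all graded ideals having zero intersection with the degree-zero component. Rings with involution. An involution on a ring $A$ is a $\mathbb{Z}$-linear map $a\mapsto a^*$ with $(ab)^*=b^*a^*$, $(a^* )^*=a$. An $R$-ring with involution is a ring $A$ with a ring homomorphism $\rho_A:R\to A$ and an involution such that $\rho_A(r)^*=\rho_A(r)$ for all $r\in R$. A map of $R$-rings with involution $k:A\to B$ is a ring homomorphism with $k\circ\rho_A=\rho_B$ and $k(a^* )=k(a)^*$. Multiquivers. A multiquiver $\Gamma=(V,E,s,t)$ consists of sets $V$, $E$ and functions $s,t:E\to (V\times\mathbb{Z}_{>0})\cup\{\emptyset\}$ such that (no loops) if $s(e)=(u,m)$ and $t(e)=(v,n)$ then $u\ne v$; and (local finiteness) for each $v\in V$ only finitely many $e$ have $s(e)\in\{v\}\times\mathbb{Z}_{>0}$ or $t(e)\in\{v\}\times\mathbb{Z}_{>0}$. The incidence matrix is $\gamma:\mathbb{Z}V\to\mathbb{Z}E$, $\gamma(v)=\sum_{e\in E}\gamma_{ev}e$, where $\gamma_{ev}=n$ if $t(e)=(v,n)$, $\gamma_{ev}=-n$ if $s(e)=(v,n)$, and $\gamma_{ev}=0$ otherwise. $\mathcal{A}(\Gamma)$ is the TGW algebra $\mathcal{A}_\mu(R_E,\sigma^\Gamma,t^\Gamma)$ with index set $V$, where all $\mu_{ij}=1$, $R_E=\Bbbk[u_e\mid e\in E]$ (polynomial algebra), $\sigma_v(u_e)=u_e-\gamma_{ev}$, $t_v=\prod_{e\in E}u_{ev}$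 with $u_{ev}=u_e(u_e+1)\cdots(u_e+\gamma_{ev}-1)$ if $\gamma_{ev}>0$, $u_{ev}=1$ if $\gamma_{ev}=0$, $u_{ev}=(u_e-1)(u_e-2)\cdots(u_e-|\gamma_{ev}|)$ if $\gamma_{ev}<0$. It is an $R_E$-ring with involution via $X_v^*=Y_v$, $Y_v^*=X_v$, $r^*=r$ for $r\in R_E$. $A_E(\Bbbk)$ is the Weyl algebra: generators $x_e,y_e$ ($e\in E$), relations $[x_e,x_{e'}]=[y_e,y_{e'}]=0$, $[y_e,x_{e'}]=\delta_{ee'}$. It is an $R_E$-ring with involution via $u_e\mapsto y_ex_e$, $x_e^*=y_e$, $y_e^*=x_e$. For $k=\sum k_ee\in\mathbb{Z}E$, $z^k=\prod_e z_e^{(k_e)}$ with $z_e^{(p)}=x_e^p$ if $p\ge0$ and $z_e^{(p)}=y_e^{-p}$ if $p<0$. *)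

(* Defs.v *)
From HB Require Import structures.
From mathcomp Require Import all_boot all_order all_algebra.
From mathcomp Require Import finmap generic_quotient.
From mathcomp Require Import boolp classical_sets cardinality.
From mathcomp Require Import monalg.

Set Implicit Arguments.
Unset Strict Implicit.
Unset Printing Implicit Defensive.

Import GRing.Theory.

Local Open Scope ring_scope.
Local Open Scope quotient_scope.

(* The free R-ring on S (scalars in R do not commute with the generators):
   formal ring expressions modulo the least congruence imposing the ring
   axioms and making [FScal] a unital ring homomorphism. *)
Section FreeRing.
Variables (R : pzRingType) (S : Type).

Inductive fterm : Type :=
| FScal of R
| FGen of S
| FAdd of fterm & fterm
| FOpp of fterm
| FMul of fterm & fterm.

Inductive fcong : fterm -> fterm -> Prop :=
| fc_refl a : fcong a a
| fc_sym a b : fcong a b -> fcong b a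
| fc_trans b a c : fcong a b -> fcong b c -> fcong a c
| fc_add a a' b b' : fcong a a' -> fcong b b' -> fcong (FAdd a b) (FAdd a' b')
| fc_opp a a' : fcong a a' -> fcong (FOpp a) (FOpp a')
| fc_mul a a' b b' : fcong a a' -> fcong b b' -> fcong (FMul a b) (FMul a' b')
| fc_addA a b c : fcong (FAdd a (FAdd b c)) (FAdd (FAdd a b) c)
| fc_addC a b : fcong (FAdd a b) (FAdd b a)
| fc_add0 a : fcong (FAdd (FScal 0) a) a
| fc_addN a : fcong (FAdd (FOpp a) a) (FScal 0)
| fc_mulA a b c : fcong (FMul a (FMul b c)) (FMul (FMul a b) c)
| fc_mul1l a : fcong (FMul (FScal 1) a) a
| fc_mul1r a : fcong (FMul a (FScal 1)) a
| fc_mulDl a b c : fcong (FMul (FAdd a b) c) (FAdd (FMul a c) (FMul b c))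
| fc_mulDr a b c : fcong (FMul a (FAdd b c)) (FAdd (FMul a b) (FMul a c))
| fc_scalD r s : fcong (FScal (r + s)) (FAdd (FScal r) (FScal s))
| fc_scalM r s : fcong (FScal (r * s)) (FMul (FScal r) (FScal s)).

HB.instance Definition _ := gen_eqMixin fterm.
HB.instance Definition _ := gen_choiceMixin fterm.

Definition fcongb (a b : fterm) : bool := `[< fcong a b >].

Lemma fcongb_refl : reflexive fcongb.
Proof. by move=> a; apply/asboolP; constructor. Qed.

Lemma fcongb_sym : symmetric fcongb.
Proof. by move=> a b; apply/asboolP/asboolP => /fc_sym. Qed.

Lemma fcongb_trans : transitive fcongb.
Proof.
move=> b a c /asboolP ab /asboolP bc; apply/asboolP; exact: fc_trans ab bc.
Qed.

Canonical fcong_equiv := EquivRel fcongb fcongb_refl fcongb_sym fcongb_trans.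

Definition freeRing : Type := {eq_quot fcong_equiv}.
HB.instance Definition _ := Choice.on freeRing.
HB.instance Definition _ := EqQuotient.on freeRing.

Definition fmk (a : fterm) : freeRing := \pi_freeRing a.

Lemma freeRingP (a b : fterm) : fmk a = fmk b <-> fcong a b.
Proof. by split=> [/eqmodP/asboolP | ab]; [|apply/eqmodP/asboolP]. Qed.

Lemma fmkK (x : freeRing) : fmk (repr x) = x.
Proof. exact: reprK. Qed.

Let rep (x : freeRing) : fterm := repr x.
Let piK (x : freeRing) : fmk (rep x) = x.
Proof. exact: reprK. Qed.
Let repK a : fcong (rep (fmk a)) a.
Proof. by apply/freeRingP; rewrite piK. Qed.

Definition fr_zero : freeRing := fmk (FScal 0).
Definition fr_one : freeRing := fmk (FScal 1).
Definition fr_add (x y : freeRing) : freeRing := fmk (FAdd (repr x) (repr y)).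
Definition fr_opp (x : freeRing) : freeRing := fmk (FOpp (repr x)).
Definition fr_mul (x y : freeRing) : freeRing := fmk (FMul (repr x) (repr y)).

Let addpi a b : fr_add (fmk a) (fmk b) = fmk (FAdd a b).
Proof. by apply/freeRingP/fc_add; apply: repK. Qed.
Let opppi a : fr_opp (fmk a) = fmk (FOpp a).
Proof. by apply/freeRingP/fc_opp; apply: repK. Qed.
Let mulpi a b : fr_mul (fmk a) (fmk b) = fmk (FMul a b).
Proof. by apply/freeRingP/fc_mul; apply: repK. Qed.

Let addA : associative fr_add.
Proof.
move=> x y z; rewrite -(piK x) -(piK y) -(piK z) !addpi.
by apply/freeRingP; constructor.
Qed.
Let addC : commutative fr_add.
Proof.
move=> x y; rewrite -(piK x) -(piK y) !addpi.
by apply/freeRingP; constructor.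
Qed.
Let add0 : left_id fr_zero fr_add.
Proof.
by move=> x; rewrite -(piK x) !addpi; apply/freeRingP; constructor.
Qed.
Let addN : left_inverse fr_zero fr_opp fr_add.
Proof.
by move=> x; rewrite -(piK x) !opppi addpi; apply/freeRingP; constructor.
Qed.
HB.instance Definition _ := GRing.isZmodule.Build freeRing addA addC add0 addN.

Let addE a b :
  fmk a + fmk b = fmk (FAdd a b) :> freeRing.
Proof. exact: addpi. Qed.

Let mulA : associative fr_mul.
Proof.
move=> x y z; rewrite -(piK x) -(piK y) -(piK z) !mulpi.
by apply/freeRingP; constructor.
Qed.
Let mul1x : left_id fr_one fr_mul.
Proof. by move=> x; rewrite -(piK x) !mulpi; apply/freeRingP; constructor. Qed.
Let mulx1 : right_id fr_one fr_mul.
Proof. by move=> x; rewrite -(piK x) !mulpi; apply/freeRingP; constructor. Qed.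
Let mulDl : left_distributive fr_mul +%R.
Proof.
move=> x y z; rewrite -(piK x) -(piK y) -(piK z) addE !mulpi addE.
by apply/freeRingP; constructor.
Qed.
Let mulDr : right_distributive fr_mul +%R.
Proof.
move=> x y z; rewrite -(piK x) -(piK y) -(piK z) addE !mulpi addE.
by apply/freeRingP; constructor.
Qed.
HB.instance Definition _ :=
  GRing.Zmodule_isPzRing.Build freeRing mulA mul1x mulx1 mulDl mulDr.

Definition fscal (r : R) : freeRing := fmk (FScal r).
Definition fgen (s : S) : freeRing := fmk (FGen s).

Lemma fmkD a b :
  fmk (FAdd a b) = fmk a + fmk b :> freeRing.
Proof. by rewrite addE. Qed.
Lemma fmkN a : fmk (FOpp a) = - fmk a :> freeRing.
Proof. by rewrite -opppi. Qed.
Lemma fmkM a b :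
  fmk (FMul a b) = fmk a * fmk b :> freeRing.
Proof. by rewrite -mulpi. Qed.

Lemma fscal_is_zmod_morphism : zmod_morphism fscal.
Proof.
have fD r s : fscal (r + s) = fscal r + fscal s.
  by rewrite -fmkD; apply/freeRingP; constructor.
move=> r s; apply: (addIr (fscal s)).
by rewrite -fD !subrK.
Qed.
HB.instance Definition _ :=
  GRing.isZmodMorphism.Build R freeRing fscal fscal_is_zmod_morphism.

Lemma fscal_is_monoid_morphism : monoid_morphism fscal.
Proof.
by split=> // r s; rewrite -fmkM; apply/freeRingP; constructor.
Qed.
HB.instance Definition _ :=
  GRing.isMonoidMorphism.Build R freeRing fscal fscal_is_monoid_morphism.

Lemma freeRing_ind (P : freeRing -> Prop) :
  (forall r, P (fscal r)) -> (forall s, P (fgen s)) ->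
  (forall x y, P x -> P y -> P (x + y)) -> (forall x, P x -> P (- x)) ->
  (forall x y, P x -> P y -> P (x * y)) -> forall x, P x.
Proof.
move=> Ps Pg PD PN PM x; rewrite -(piK x).
elim: (rep x) => [r|s|a Pa b Pb|a Pa|a Pa b Pb].
- exact: Ps.
- exact: Pg.
- by rewrite fmkD; apply: PD.
- by rewrite fmkN; apply: PN.
- by rewrite fmkM; apply: PM.
Qed.

Section Lift.
Variables (B : pzRingType) (f : {rmorphism R -> B}) (g : S -> B).

Fixpoint feval (a : fterm) : B :=
  match a with
  | FScal r => f r
  | FGen s => g s
  | FAdd a b => feval a + feval b
  | FOpp a => - feval a
  | FMul a b => feval a * feval b
  end.

Lemma feval_cong a b : fcong a b -> feval a = feval b.
Proof.
elim=> //= {a b}.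
- by move=> b a c _ -> _ ->.
- by move=> a a' b b' _ -> _ ->.
- by move=> a a' _ ->.
- by move=> a a' b b' _ -> _ ->.
- by move=> *; rewrite addrA.
- by move=> *; rewrite addrC.
- by move=> *; rewrite rmorph0 add0r.
- by move=> *; rewrite rmorph0 addNr.
- by move=> *; rewrite mulrA.
- by move=> *; rewrite rmorph1 mul1r.
- by move=> *; rewrite rmorph1 mulr1.
- by move=> *; rewrite mulrDl.
- by move=> *; rewrite mulrDr.
- by move=> *; rewrite rmorphD.
- by move=> *; rewrite rmorphM.
Qed.

(* Universal property of the free R-ring; uniqueness is [freeRing_ind]. *)
Definition flift (x : freeRing) : B := feval (repr x).

Lemma flift_pi a : flift (fmk a) = feval a.
Proof. exact/feval_cong/repK. Qed.
Lemma flift_scal r : flift (fscal r) = f r. Proof. exact: flift_pi. Qed.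
Lemma flift_gen s : flift (fgen s) = g s. Proof. exact: flift_pi. Qed.

Lemma flift_is_zmod_morphism : zmod_morphism flift.
Proof.
move=> x y; rewrite -(piK x) -(piK y) -fmkN -fmkD.
by rewrite !flift_pi.
Qed.
HB.instance Definition _ :=
  GRing.isZmodMorphism.Build freeRing B flift flift_is_zmod_morphism.
Lemma flift_is_monoid_morphism : monoid_morphism flift.
Proof.
split=> [|x y]; first by rewrite [LHS]flift_scal rmorph1.
by rewrite -(piK x) -(piK y) -fmkM !flift_pi.
Qed.
HB.instance Definition _ :=
  GRing.isMonoidMorphism.Build freeRing B flift flift_is_monoid_morphism.
End Lift.
End FreeRing.

Record involution (A : pzRingType) (star : A -> A) : Prop := Involution {
  involution_zmod : zmod_morphism star;
  involutionM : forall a b, star (a * b) = star b * star a;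
  involutionK : involutive star
}.

Section InvolutionTheory.
Variables (A : pzRingType) (star : A -> A).
Hypothesis starP : involution star.

Lemma involution0 : star 0 = 0.
Proof. by rewrite -[in LHS](subrr 0) (involution_zmod starP) subrr. Qed.
Lemma involutionN a : star (- a) = - star a.
Proof.
by rewrite -[in LHS](sub0r a) (involution_zmod starP) involution0 sub0r.
Qed.
Lemma involutionD a b : star (a + b) = star a + star b.
Proof.
by rewrite -[in LHS](opprK b) (involution_zmod starP) involutionN opprK.
Qed.
Lemma involution1 : star 1 = 1.
Proof.
rewrite -[LHS]mulr1 -[X in _ * X = _](involutionK starP 1).
by rewrite -(involutionM starP) mulr1 (involutionK starP).
Qed.
End InvolutionTheory.

(* The involution of a free R-ring, R commutative, that fixes the scalars and
   permutes the generators by [sw]. *)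
Section FreeRingStar.
Variables (R : comPzRingType) (S : Type) (sw : S -> S).

Fixpoint ft_star (a : fterm R S) : fterm R S :=
  match a with
  | FScal r => FScal _ r
  | FGen s => FGen _ (sw s)
  | FAdd a b => FAdd (ft_star a) (ft_star b)
  | FOpp a => FOpp (ft_star a)
  | FMul a b => FMul (ft_star b) (ft_star a)
  end.

Lemma ft_star_cong a b : fcong a b -> fcong (ft_star a) (ft_star b).
Proof.
elim=> //= {a b}; try by move=> *; constructor.
- by move=> b a c _ ab _ bc; apply: fc_trans ab bc.
- by move=> a b c; apply/fc_sym/fc_mulA.
- by move=> r s; rewrite mulrC; apply: fc_scalM.
Qed.

Definition fr_star (x : freeRing R S) : freeRing R S := fmk (ft_star (repr x)).

Lemma fr_star_pi a : fr_star (fmk a) = fmk (ft_star a).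
Proof. by apply/freeRingP/ft_star_cong/freeRingP; rewrite fmkK. Qed.

Lemma fr_star_scal r : fr_star (fscal S r) = fscal S r.
Proof. exact: fr_star_pi. Qed.
Lemma fr_star_gen s : fr_star (fgen R s) = fgen R (sw s).
Proof. exact: fr_star_pi. Qed.

Lemma fr_starP : involutive sw -> involution fr_star.
Proof.
move=> swK; split.
- move=> x y; rewrite -(fmkK x) -(fmkK y) -fmkN -fmkD.
  by rewrite !fr_star_pi -fmkN -fmkD.
- move=> x y; rewrite -(fmkK x) -(fmkK y) -fmkM.
  by rewrite !fr_star_pi -fmkM.
- move=> x; rewrite -(fmkK x) !fr_star_pi; congr (fmk _).
  by elim: (repr x) => //= [s|a -> b ->|a ->|a -> b ->] //; rewrite swK.
Qed.
End FreeRingStar.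

Record ideal (A : pzRingType) : Type := Ideal {
  ideal_mem :> A -> Prop;
  ideal0 : ideal_mem 0;
  idealD : forall a b, ideal_mem a -> ideal_mem b -> ideal_mem (a + b);
  idealMl : forall c a, ideal_mem a -> ideal_mem (c * a);
  idealMr : forall c a, ideal_mem a -> ideal_mem (a * c)
}.

Lemma idealN (A : pzRingType) (J : ideal A) a : J a -> J (- a).
Proof. by move=> Ja; rewrite -mulN1r; apply: idealMl. Qed.

Lemma idealB (A : pzRingType) (J : ideal A) a b : J a -> J b -> J (a - b).
Proof. by move=> Ja /idealN Jb; apply: idealD. Qed.

(* The two-sided ideal generated by the differences [a - b], [rel a b]. *)
Inductive rel_ideal_mem (A : pzRingType) (rel : A -> A -> Prop) : A -> Prop :=
| ri_rel a b : rel a b -> rel_ideal_mem rel (a - b)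
| ri_0 : rel_ideal_mem rel 0
| ri_add a b : rel_ideal_mem rel a -> rel_ideal_mem rel b ->
    rel_ideal_mem rel (a + b)
| ri_mull c a : rel_ideal_mem rel a -> rel_ideal_mem rel (c * a)
| ri_mulr c a : rel_ideal_mem rel a -> rel_ideal_mem rel (a * c).

Definition rel_ideal (A : pzRingType) (rel : A -> A -> Prop) : ideal A :=
  Ideal (ri_0 rel) (@ri_add A rel) (@ri_mull A rel) (@ri_mulr A rel).

Section QuotientRing.
Variables (A : pzRingType) (J : ideal A).

Definition ideal_eq (a b : A) : bool := `[< J (a - b) >].

Lemma ideal_eq_refl : reflexive ideal_eq.
Proof. by move=> a; apply/asboolP; rewrite subrr; apply: ideal0. Qed.

Lemma ideal_eq_sym : symmetric ideal_eq.
Proof. by move=> a b; apply/asboolP/asboolP => /idealN; rewrite opprB. Qed.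

Lemma ideal_eq_trans : transitive ideal_eq.
Proof.
move=> b a c /asboolP ab /asboolP bc; apply/asboolP.
by rewrite -(subrKA b); apply: idealD.
Qed.

Canonical ideal_equiv :=
  EquivRel ideal_eq ideal_eq_refl ideal_eq_sym ideal_eq_trans.

Definition quotRing : Type := {eq_quot ideal_equiv}.
HB.instance Definition _ := Choice.on quotRing.
HB.instance Definition _ := EqQuotient.on quotRing.

Definition qproj (a : A) : quotRing := \pi_quotRing a.

Lemma qproj_eq (a b : A) : qproj a = qproj b <-> J (a - b).
Proof. by split=> [/eqmodP/asboolP | ab]; [|apply/eqmodP/asboolP]. Qed.

Let rep (x : quotRing) : A := repr x.
Let piK (x : quotRing) : qproj (rep x) = x.
Proof. exact: reprK. Qed.
Let repK a : J (rep (qproj a) - a).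
Proof. by apply/qproj_eq; rewrite piK. Qed.

Definition qr_zero : quotRing := qproj 0.
Definition qr_one : quotRing := qproj 1.
Definition qr_add (x y : quotRing) : quotRing := qproj (repr x + repr y).
Definition qr_opp (x : quotRing) : quotRing := qproj (- repr x).
Definition qr_mul (x y : quotRing) : quotRing := qproj (repr x * repr y).

Let addpi a b : qr_add (qproj a) (qproj b) = qproj (a + b).
Proof.
by apply/qproj_eq; rewrite opprD addrACA; apply: idealD; apply: repK.
Qed.
Let opppi a : qr_opp (qproj a) = qproj (- a).
Proof.
by apply/qproj_eq; rewrite -opprD; apply: idealN; apply: repK.
Qed.
Let mulpi a b : qr_mul (qproj a) (qproj b) = qproj (a * b).
Proof.
apply/qproj_eq; rewrite -(subrKA (a * rep (qproj b))).
rewrite -mulrBl -mulrBr.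
by apply: idealD; [apply: idealMr|apply: idealMl]; apply: repK.
Qed.

Let addA : associative qr_add.
Proof.
by move=> x y z; rewrite -(piK x) -(piK y) -(piK z) !addpi addrA.
Qed.
Let addC : commutative qr_add.
Proof. by move=> x y; rewrite -(piK x) -(piK y) !addpi addrC. Qed.
Let add0 : left_id qr_zero qr_add.
Proof. by move=> x; rewrite -(piK x) !addpi add0r. Qed.
Let addN : left_inverse qr_zero qr_opp qr_add.
Proof. by move=> x; rewrite -(piK x) opppi addpi addNr. Qed.
HB.instance Definition _ := GRing.isZmodule.Build quotRing addA addC add0 addN.

Let addE a b :
  qproj a + qproj b = qproj (a + b) :> quotRing.
Proof. exact: addpi. Qed.

Let mulA : associative qr_mul.
Proof.
by move=> x y z; rewrite -(piK x) -(piK y) -(piK z) !mulpi mulrA.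
Qed.
Let mul1x : left_id qr_one qr_mul.
Proof. by move=> x; rewrite -(piK x) !mulpi mul1r. Qed.
Let mulx1 : right_id qr_one qr_mul.
Proof. by move=> x; rewrite -(piK x) !mulpi mulr1. Qed.
Let mulDl : left_distributive qr_mul +%R.
Proof.
by move=> x y z; rewrite -(piK x) -(piK y) -(piK z) addE !mulpi addE mulrDl.
Qed.
Let mulDr : right_distributive qr_mul +%R.
Proof.
by move=> x y z; rewrite -(piK x) -(piK y) -(piK z) addE !mulpi addE mulrDr.
Qed.
HB.instance Definition _ :=
  GRing.Zmodule_isPzRing.Build quotRing mulA mul1x mulx1 mulDl mulDr.

Lemma qproj_surj (x : quotRing) : exists a, x = qproj a.
Proof. by exists (rep x); rewrite -[LHS]piK. Qed.

Lemma qproj_is_zmod_morphism : zmod_morphism qproj.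
Proof. by move=> a b; rewrite -[LHS]addpi -opppi. Qed.
HB.instance Definition _ :=
  GRing.isZmodMorphism.Build A quotRing qproj qproj_is_zmod_morphism.
Lemma qproj_is_monoid_morphism : monoid_morphism qproj.
Proof. by split=> // a b; rewrite -[LHS]mulpi. Qed.
HB.instance Definition _ :=
  GRing.isMonoidMorphism.Build A quotRing qproj qproj_is_monoid_morphism.

Definition qr_star (star : A -> A) (x : quotRing) : quotRing :=
  qproj (star (repr x)).

Section Star.
Variable star : A -> A.
Hypotheses (starP : involution star) (starJ : forall a, J a -> J (star a)).

Lemma qr_star_proj a : qr_star star (qproj a) = qproj (star a).
Proof.
by apply/qproj_eq; rewrite -(involution_zmod starP); apply/starJ/repK.
Qed.

Lemma qr_starP : involution (qr_star star).
Proof.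
split.
- move=> x y; have [a ->] := qproj_surj x; have [b ->] := qproj_surj y.
  by rewrite -rmorphB !qr_star_proj (involution_zmod starP) rmorphB.
- move=> x y; have [a ->] := qproj_surj x; have [b ->] := qproj_surj y.
  by rewrite -rmorphM !qr_star_proj (involutionM starP) rmorphM.
- move=> x; have [a ->] := qproj_surj x.
  by rewrite !qr_star_proj (involutionK starP).
Qed.
End Star.
End QuotientRing.

Lemma rel_ideal_star (A : pzRingType) (rel : A -> A -> Prop) (star : A -> A) :
  involution star ->
  (forall a b, rel a b -> rel_ideal rel (star a - star b)) ->
  forall a, rel_ideal rel a -> rel_ideal rel (star a).
Proof.
move=> starP relS a; elim=> {a}.
- by move=> a b /relS; rewrite (involution_zmod starP).
- by rewrite (involution0 starP); apply: ideal0.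
- by move=> a b _ Ja _ Jb; rewrite (involutionD starP); apply: idealD.
- by move=> c a _ Ja; rewrite (involutionM starP); apply: idealMr.
- by move=> c a _ Ja; rewrite (involutionM starP); apply: idealMl.
Qed.

(* The polynomial algebra k[u_e | e in E]; E may be infinite. *)
Notation polyAlg k E := {malg k[{cmonom E}]}.

Definition pvar (k : fieldType) (E : choiceType) (e : E) : polyAlg k E :=
  << ucm e >>.

Lemma polyAlg_ind (k : fieldType) (E : choiceType) (P : polyAlg k E -> Prop) :
  (forall c, P c%:MP) -> (forall e, P (pvar k e)) ->
  (forall p q, P p -> P q -> P (p + q)) ->
  (forall p q, P p -> P q -> P (p * q)) -> forall p, P p.
Proof.
move=> PC PX PD PM p; rewrite [p]monalgE; apply: big_ind => //.
  by have := PC 0; rewrite malgC0E.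
move=> m _; have [n] := ubnP (mdeg m).
elim: n m (p@_m) => // n IHn m c; rewrite ltnS => lemn.
have [/eqP/mdeg_eq0I -> //|] := boolP (mdeg m == 0%N).
rewrite mdeg_eq0 => m1.
have [e e_m] : exists e, m e != 0%N.
  apply: contrapT => /forallNP m0; move/negP: m1; apply; apply/cmP => e.
  by rewrite cm1; apply/eqP; apply: contrapT => /negP/m0.
have mE : m = mmul (ucm e) (divcm m (ucm e)).
  apply/eqP/cmP => i; rewrite cmM cmU divcmE cmU.
  by case: eqP => [<-|_] /=; [rewrite subnKC ?lt0n|rewrite add0n subn0].
have -> : << c *g m >> = pvar k e * << c *g divcm m (ucm e) >>.
  by rewrite /pvar malgM_def fgmulUU mul1r -mE.
apply: PM => //; apply: IHn.
by move: lemn; rewrite {1}mE mdegM mdegU add1n.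
Qed.

Lemma polyAlg_rmorph_ext (k : fieldType) (E : choiceType) (B : pzRingType)
    (f g : {rmorphism polyAlg k E -> B}) :
  (forall c, f c%:MP = g c%:MP) -> (forall e, f (pvar k e) = g (pvar k e)) ->
  f =1 g.
Proof.
move=> fgC fgX; apply: polyAlg_ind => // p q IHp IHq.
  by rewrite !rmorphD IHp IHq.
by rewrite !rmorphM IHp IHq.
Qed.

Lemma perm_prod_comm (B : pzRingType) (T : eqType) (F : T -> B) (s t : seq T) :
  (forall x y, GRing.comm (F x) (F y)) -> perm_eq s t ->
  \prod_(x <- s) F x = \prod_(x <- t) F x.
Proof.
move=> FC; elim: s t => [|x s IHs] t.
  by rewrite perm_sym => /perm_nilP->.
move=> st; have xt : x \in t by rewrite -(perm_mem st) mem_head.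
case/splitPr: xt st => t1 t2; rewrite perm_sym perm_catC /= perm_cons.
rewrite perm_catC perm_sym => /IHs st.
rewrite big_cons st !big_cat /= big_cons !mulrA; congr (_ * _).
exact: commr_prod.
Qed.

(* Substitution of pairwise commuting elements [h e] for the variables. *)
Section PolyEval.
Variables (k : fieldType) (E : choiceType) (B : pzRingType).
Variables (f : {rmorphism k -> B}) (h : E -> B).

Definition monEval (m : {cmonom E}) : B :=
  \prod_(e <- finsupp m) h e ^+ m e.

Definition polyEval (p : polyAlg k E) : B :=
  \sum_(m <- msupp p) f p@_m * monEval m.

Lemma polyEvalEw (d : {fset {cmonom E}}) (p : polyAlg k E) :
  (msupp p `<=` d)%fset -> polyEval p = \sum_(m <- d) f p@_m * monEval m.
Proof.
move=> le; apply/big_fset_incl => // m _ /mcoeff_outdom ->.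
by rewrite rmorph0 mul0r.
Qed.

Lemma polyEval_is_zmod_morphism : zmod_morphism polyEval.
Proof.
move=> p q; pose d := (msupp p `|` msupp q)%fset.
rewrite !(@polyEvalEw d) ?fsubsetUl ?fsubsetUr ?msuppB_le //.
by rewrite -sumrB; apply: eq_bigr => m _; rewrite mcoeffB rmorphB mulrBl.
Qed.
HB.instance Definition _ :=
  GRing.isZmodMorphism.Build (polyAlg k E) B polyEval polyEval_is_zmod_morphism.

Lemma polyEvalU c m : polyEval << c *g m >> = f c * monEval m.
Proof.
rewrite (@polyEvalEw [fset m]%fset) ?msuppU_le //.
by rewrite big_seq_fset1 mcoeffUU.
Qed.

Lemma monEval1 : monEval mone = 1.
Proof. by rewrite /monEval mdom1 big_seq_fset0. Qed.

Lemma polyEvalC c : polyEval c%:MP = f c.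
Proof. by rewrite polyEvalU monEval1 mulr1. Qed.

Lemma polyEval_var e : polyEval (pvar k e) = h e.
Proof.
rewrite polyEvalU rmorph1 mul1r /monEval mdomU big_seq_fset1.
by rewrite cmUU expr1.
Qed.

Hypothesis hC : forall e e', GRing.comm (h e) (h e').
Hypothesis fC : forall c e, GRing.comm (f c) (h e).

Lemma monEvalEw (d : {fset E}) (m : {cmonom E}) :
  (finsupp m `<=` d)%fset -> monEval m = \prod_(e <- d) h e ^+ m e.
Proof.
move=> le; rewrite -[RHS](big_rmcond [in finsupp m]); last first.
  by move=> e; rewrite -cmE_eq0 => /eqP ->.
rewrite -[RHS]big_filter; apply: perm_prod_comm.
  by move=> e e'; apply/commrX/commr_sym/commrX.
apply: uniq_perm; rewrite ?filter_uniq ?fset_uniq // => e.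
by rewrite mem_filter; case: (boolP (e \in _)) => // /(fsubsetP le) ->.
Qed.

Lemma monEvalM m n : monEval (mmul m n) = monEval m * monEval n.
Proof.
pose d := (finsupp m `|` finsupp n)%fset.
rewrite !(@monEvalEw d) ?fsubsetUl ?fsubsetUr ?mdomD //.
rewrite -prodrM_comm; first by apply: eq_bigr => e _; rewrite cmM exprD.
by move=> e e' _ _; apply/commrX/commr_sym/commrX.
Qed.

Lemma polyEval_is_monoid_morphism : monoid_morphism polyEval.
Proof.
split=> [|p q]; first by rewrite polyEvalC rmorph1.
rewrite malgME raddf_sum mulr_suml /=; apply: eq_bigr=> m _.
rewrite raddf_sum mulr_sumr /=; apply: eq_bigr=> n _.
rewrite polyEvalU rmorphM monEvalM -!mulrA; congr (_ * _); rewrite !mulrA.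
by congr (_ * _); apply: commr_prod => e _; apply/commrX.
Qed.
End PolyEval.

Section PolyEvalCom.
Variables (k : fieldType) (E : choiceType) (B : comPzRingType).
Variables (f : {rmorphism k -> B}) (h : E -> B).

Lemma polyEval_com_is_monoid_morphism : monoid_morphism (polyEval f h).
Proof. by apply: polyEval_is_monoid_morphism => *; apply: mulrC. Qed.
HB.instance Definition _ :=
  GRing.isMonoidMorphism.Build (polyAlg k E) B (polyEval f h)
    polyEval_com_is_monoid_morphism.
End PolyEvalCom.

(* The k-algebra endomorphism of k[u_e | e in E] with u_e |-> h e. *)
Section PolySubst.
Variables (k : fieldType) (E : choiceType).

Definition polySubst (h : E -> polyAlg k E) : polyAlg k E -> polyAlg k E :=
  polyEval malgC h.

HB.instance Definition _ h := GRing.RMorphism.on (polySubst h).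

Lemma polySubst_is_scalable h : scalable (polySubst h).
Proof. by move=> c p; rewrite -!mul_malgC rmorphM /= /polySubst polyEvalC. Qed.
HB.instance Definition _ h :=
  GRing.isScalable.Build k (polyAlg k E) (polyAlg k E) *:%R (polySubst h)
    (polySubst_is_scalable h).

Lemma polySubstC h c : polySubst h c%:MP = c%:MP.
Proof. exact: polyEvalC. Qed.
Lemma polySubst_var h e : polySubst h (pvar k e) = h e.
Proof. exact: polyEval_var. Qed.
End PolySubst.

Record invRing (R : pzRingType) : Type := InvRing {
  ir_ring :> pzRingType;
  ir_rho : {rmorphism R -> ir_ring};
  ir_star : ir_ring -> ir_ring;
  ir_starP : involution ir_star;
  ir_rho_star : forall r, ir_star (ir_rho r) = ir_rho r
}.

Record invRing_map (R : pzRingType) (A B : invRing R) (f : A -> B) : Prop :=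
  InvRingMap {
  irm_zmod : zmod_morphism f;
  irm_monoid : monoid_morphism f;
  irm_rho : forall r, f (ir_rho A r) = ir_rho B r;
  irm_star : forall a, f (ir_star a) = ir_star (f a)
}.

Record tgwDatum (k : fieldType) (I : choiceType) (R : algType k) : Type :=
  TgwDatum {
  tgw_sigma : I -> {lrmorphism R -> R};
  tgw_sigmaV : I -> R -> R;
  tgw_sigmaK : forall i, cancel (tgw_sigma i) (tgw_sigmaV i);
  tgw_sigmaVK : forall i, cancel (tgw_sigmaV i) (tgw_sigma i);
  tgw_sigmaC : forall i j r,
    tgw_sigma i (tgw_sigma j r) = tgw_sigma j (tgw_sigma i r);
  tgw_t : I -> R;
  tgw_t_neq0 : forall i, tgw_t i != 0;
  tgw_t_central : forall i r, GRing.comm (tgw_t i) r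
}.

(* The diagonal values [mu i i] are irrelevant. *)
Record tgwMu (k : fieldType) (I : choiceType) : Type := TgwMu {
  tgw_mu :> I -> I -> k;
  tgw_mu_neq0 : forall i j, i != j -> tgw_mu i j != 0
}.

Variant xyGen (I : Type) : Type := GX of I | GY of I.
Arguments GX {I}.
Arguments GY {I}.

Section TGW.
Variables (k : fieldType) (I : choiceType) (R : algType k).
Variables (D : tgwDatum I R) (mu : tgwMu k I).

Local Notation sc := (@fscal R (xyGen I)).
Local Notation X i := (fgen R (GX i)).
Local Notation Y i := (fgen R (GY i)).

Inductive tgw_rel : freeRing R (xyGen I) -> freeRing R (xyGen I) -> Prop :=
| tgw_rel_Xr i r : tgw_rel (X i * sc r) (sc (tgw_sigma D i r) * X i)
| tgw_rel_Yr i r : tgw_rel (Y i * sc r) (sc (tgw_sigmaV D i r) * Y i)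
| tgw_rel_YX i : tgw_rel (Y i * X i) (sc (tgw_t D i))
| tgw_rel_XY i : tgw_rel (X i * Y i) (sc (tgw_sigma D i (tgw_t D i)))
| tgw_rel_mu i j : i != j ->
    tgw_rel (X i * Y j) (sc (mu i j)%:A * (Y j * X i)).

Definition tgwC : Type := quotRing (rel_ideal tgw_rel).
HB.instance Definition _ := GRing.PzRing.on tgwC.

Definition tgwC_rho (r : R) : tgwC := qproj (rel_ideal tgw_rel) (sc r).
Definition tgwC_X (i : I) : tgwC := qproj (rel_ideal tgw_rel) (X i).
Definition tgwC_Y (i : I) : tgwC := qproj (rel_ideal tgw_rel) (Y i).

(* [tgw_homog d] is the component of degree d for the grading of [tgwC] by
   the free abelian group [{malg int[I]}] on I. *)
Inductive tgw_homog : {malg int[I]} -> tgwC -> Prop :=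
| th_rho r : tgw_homog 0 (tgwC_rho r)
| th_X i : tgw_homog << i >> (tgwC_X i)
| th_Y i : tgw_homog (- << i >>) (tgwC_Y i)
| th_0 d : tgw_homog d 0
| th_add d a b : tgw_homog d a -> tgw_homog d b -> tgw_homog d (a + b)
| th_mul d d' a b : tgw_homog d a -> tgw_homog d' b ->
    tgw_homog (d + d') (a * b).

Definition graded_ideal (K : ideal tgwC) : Prop :=
  forall a, K a -> exists s : seq tgwC,
    (forall b, b \in s -> K b /\ exists d, tgw_homog d b) /\
    a = \sum_(b <- s) b.

Definition trivial_in_degree0 (K : ideal tgwC) : Prop :=
  forall a, K a -> tgw_homog 0 a -> a = 0.

(* The sum of the graded ideals having zero intersection with degree 0. *)
Inductive tgw_rad_mem : tgwC -> Prop :=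
| tr_in (K : ideal tgwC) a :
    graded_ideal K -> trivial_in_degree0 K -> K a -> tgw_rad_mem a
| tr_0 : tgw_rad_mem 0
| tr_add a b : tgw_rad_mem a -> tgw_rad_mem b -> tgw_rad_mem (a + b).

Lemma tgw_rad_mull c a : tgw_rad_mem a -> tgw_rad_mem (c * a).
Proof.
elim=> {a} [K a gK tK Ka||a b _ Ja _ Jb].
- by apply: (tr_in gK tK); apply: idealMl.
- by rewrite mulr0; apply: tr_0.
- by rewrite mulrDr; apply: tr_add.
Qed.

Lemma tgw_rad_mulr c a : tgw_rad_mem a -> tgw_rad_mem (a * c).
Proof.
elim=> {a} [K a gK tK Ka||a b _ Ja _ Jb].
- by apply: (tr_in gK tK); apply: idealMr.
- by rewrite mul0r; apply: tr_0.
- by rewrite mulrDl; apply: tr_add.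
Qed.

Definition tgw_rad : ideal tgwC := Ideal tr_0 tr_add tgw_rad_mull tgw_rad_mulr.

Definition tgwA : Type := quotRing tgw_rad.
HB.instance Definition _ := GRing.PzRing.on tgwA.

Definition tgwA_rho (r : R) : tgwA := qproj tgw_rad (tgwC_rho r).
Definition tgwA_X (i : I) : tgwA := qproj tgw_rad (tgwC_X i).
Definition tgwA_Y (i : I) : tgwA := qproj tgw_rad (tgwC_Y i).

Lemma tgwA_rho_is_zmod_morphism : zmod_morphism tgwA_rho.
Proof. by move=> r s; rewrite /tgwA_rho /tgwC_rho !rmorphB. Qed.
HB.instance Definition _ :=
  GRing.isZmodMorphism.Build R tgwA tgwA_rho tgwA_rho_is_zmod_morphism.
Lemma tgwA_rho_is_monoid_morphism : monoid_morphism tgwA_rho.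
Proof.
by split=> [|r s]; rewrite /tgwA_rho /tgwC_rho ?rmorph1 // !rmorphM.
Qed.
HB.instance Definition _ :=
  GRing.isMonoidMorphism.Build R tgwA tgwA_rho tgwA_rho_is_monoid_morphism.
End TGW.

(* For R commutative and mu symmetric, the relations are stable under the
   anti-automorphism exchanging X_i and Y_i and fixing R. *)
Section TGWStar.
Variables (k : fieldType) (I : choiceType) (R : comAlgType k).
Variables (D : tgwDatum I R) (mu : tgwMu k I).

Definition xy_swap (g : xyGen I) : xyGen I :=
  match g with GX i => GY i | GY i => GX i end.

Lemma xy_swapK : involutive xy_swap. Proof. by case. Qed.

Definition tgwC_star : tgwC D mu -> tgwC D mu := qr_star (fr_star xy_swap).
Definition tgwA_star : tgwA D mu -> tgwA D mu := qr_star tgwC_star.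

Hypothesis muC : forall i j, mu i j = mu j i.

Let frP := @fr_starP R (xyGen I) xy_swap xy_swapK.

Let starE := (fr_star_scal, fr_star_gen, involutionM frP).

Lemma tgw_rel_star a b : tgw_rel D mu a b ->
  rel_ideal (tgw_rel D mu) (fr_star xy_swap a - fr_star xy_swap b).
Proof.
pose q := qproj (rel_ideal (tgw_rel D mu)).
have rE x y : tgw_rel D mu x y -> q x = q y by move=> xy; apply/qproj_eq/ri_rel.
move=> ab; apply/qproj_eq; rewrite -/q.
case: ab => [i r|i r|i|i|i j ij]; rewrite !starE.
- by rewrite (rE _ _ (tgw_rel_Yr D mu i _)) tgw_sigmaK.
- by rewrite (rE _ _ (tgw_rel_Xr D mu i _)) tgw_sigmaVK.
- exact/rE/tgw_rel_YX.
- exact/rE/tgw_rel_XY.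
- rewrite eq_sym in ij; rewrite (rE _ _ (tgw_rel_mu D mu ij)) muC.
  have sA c : tgw_sigma D j c%:A = c%:A by rewrite linearZ rmorph1.
  have sVA c : tgw_sigmaV D i c%:A = c%:A.
    by rewrite -[in LHS](rmorph1 (tgw_sigma D i)) -linearZ tgw_sigmaK.
  have qM x y : q (x * y) = q x * q y by exact: rmorphM.
  rewrite -[in RHS]mulrA [RHS]qM (rE _ _ (tgw_rel_Xr D mu j _)) -[RHS]qM.
  rewrite sA [in RHS]mulrA [RHS]qM (rE _ _ (tgw_rel_Yr D mu i _)).
  by rewrite sVA -[RHS]qM [in LHS]mulrA.
Qed.

Lemma tgwC_star_proj a :
  tgwC_star (qproj _ a) = qproj _ (fr_star xy_swap a).
Proof. exact: (qr_star_proj frP (rel_ideal_star frP tgw_rel_star)). Qed.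

Lemma tgwC_starP : involution tgwC_star.
Proof. exact: (qr_starP frP (rel_ideal_star frP tgw_rel_star)). Qed.

Lemma tgwC_star_rho r : tgwC_star (tgwC_rho D mu r) = tgwC_rho D mu r.
Proof. by rewrite /tgwC_rho tgwC_star_proj fr_star_scal. Qed.
Lemma tgwC_star_X i : tgwC_star (tgwC_X D mu i) = tgwC_Y D mu i.
Proof. by rewrite /tgwC_X tgwC_star_proj fr_star_gen. Qed.
Lemma tgwC_star_Y i : tgwC_star (tgwC_Y D mu i) = tgwC_X D mu i.
Proof. by rewrite /tgwC_Y tgwC_star_proj fr_star_gen. Qed.

Lemma tgw_homog_star d a : tgw_homog d a -> tgw_homog (- d) (tgwC_star a).
Proof.
elim=> {d a} [r|i|i|d|d a b _ IHa _ IHb|d d' a b _ IHa _ IHb].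
- by rewrite oppr0 tgwC_star_rho; apply: th_rho.
- by rewrite tgwC_star_X; apply: th_Y.
- by rewrite opprK tgwC_star_Y; apply: th_X.
- by rewrite (involution0 tgwC_starP); apply: th_0.
- by rewrite (involutionD tgwC_starP); apply: th_add.
- by rewrite (involutionM tgwC_starP) opprD addrC; apply: th_mul.
Qed.

Section IdealStar.
Variable K : ideal (tgwC D mu).
Let mem (a : tgwC D mu) := K (tgwC_star a).
Let mem0 : mem 0.
Proof. by rewrite /mem (involution0 tgwC_starP); apply: ideal0. Qed.
Let memD a b : mem a -> mem b -> mem (a + b).
Proof. by rewrite /mem (involutionD tgwC_starP); apply: idealD. Qed.
Let memMl c a : mem a -> mem (c * a).
Proof. by rewrite /mem (involutionM tgwC_starP); apply: idealMr. Qed.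
Let memMr c a : mem a -> mem (a * c).
Proof. by rewrite /mem (involutionM tgwC_starP); apply: idealMl. Qed.

Definition ideal_star : ideal (tgwC D mu) := Ideal mem0 memD memMl memMr.

Lemma ideal_star_graded : graded_ideal K -> graded_ideal ideal_star.
Proof.
move=> gK a /gK[s [sP sE]]; exists (map tgwC_star s); split.
  move=> _ /mapP[b /sP[Kb [d hb]] ->]; split.
    by rewrite /= /mem (involutionK tgwC_starP).
  by exists (- d); apply: tgw_homog_star.
rewrite -[LHS](involutionK tgwC_starP) sE big_map.
apply: (big_morph tgwC_star); last exact: involution0 tgwC_starP.
exact: involutionD tgwC_starP.
Qed.

Lemma ideal_star_trivial :
  trivial_in_degree0 K -> trivial_in_degree0 ideal_star.
Proof.
move=> tK a Ka /tgw_homog_star; rewrite oppr0 => /(tK _ Ka) a0.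
by rewrite -[LHS](involutionK tgwC_starP) a0 (involution0 tgwC_starP).
Qed.
End IdealStar.

Lemma tgw_rad_star a : tgw_rad D mu a -> tgw_rad D mu (tgwC_star a).
Proof.
elim=> {a} [K a gK tK Ka||a b _ Ja _ Jb].
- apply: (tr_in (ideal_star_graded gK) (ideal_star_trivial tK)).
  by rewrite /= (involutionK tgwC_starP).
- by rewrite (involution0 tgwC_starP); apply: ideal0.
- by rewrite (involutionD tgwC_starP); apply: tr_add.
Qed.

Lemma tgwA_starP : involution tgwA_star.
Proof. exact: (qr_starP tgwC_starP tgw_rad_star). Qed.

Lemma tgwA_star_proj a : tgwA_star (qproj _ a) = qproj _ (tgwC_star a).
Proof. exact: (qr_star_proj tgwC_starP tgw_rad_star). Qed.

Lemma tgwA_star_rho r : tgwA_star (tgwA_rho D mu r) = tgwA_rho D mu r.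
Proof. by rewrite /tgwA_rho tgwA_star_proj tgwC_star_rho. Qed.
Lemma tgwA_star_X i : tgwA_star (tgwA_X D mu i) = tgwA_Y D mu i.
Proof. by rewrite /tgwA_X tgwA_star_proj tgwC_star_X. Qed.
Lemma tgwA_star_Y i : tgwA_star (tgwA_Y D mu i) = tgwA_X D mu i.
Proof. by rewrite /tgwA_Y tgwA_star_proj tgwC_star_Y. Qed.
End TGWStar.

(* A_E(k), as a k-ring; [weyl_scal] makes the scalars central. *)
Section Weyl.
Variables (k : fieldType) (E : choiceType).

Local Notation sc := (@fscal k (xyGen E)).
Local Notation x e := (fgen k (GX e)).
Local Notation y e := (fgen k (GY e)).

Inductive weyl_rel : freeRing k (xyGen E) -> freeRing k (xyGen E) -> Prop :=
| weyl_scal c g : weyl_rel (sc c * fgen k g) (fgen k g * sc c)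
| weyl_xx e e' : weyl_rel (x e * x e' - x e' * x e) 0
| weyl_yy e e' : weyl_rel (y e * y e' - y e' * y e) 0
| weyl_yx e e' : weyl_rel (y e * x e' - x e' * y e) (e == e')%:R.

Definition weyl : Type := quotRing (rel_ideal weyl_rel).
HB.instance Definition _ := GRing.PzRing.on weyl.

Local Notation q := (qproj (rel_ideal weyl_rel)).

Definition weyl_c (c : k) : weyl := q (sc c).
Definition weyl_x (e : E) : weyl := q (x e).
Definition weyl_y (e : E) : weyl := q (y e).

Lemma weyl_c_is_zmod_morphism : zmod_morphism weyl_c.
Proof. by move=> r s; rewrite /weyl_c !rmorphB. Qed.
HB.instance Definition _ :=
  GRing.isZmodMorphism.Build k weyl weyl_c weyl_c_is_zmod_morphism.
Lemma weyl_c_is_monoid_morphism : monoid_morphism weyl_c.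
Proof. by split=> [|r s]; rewrite /weyl_c ?rmorph1 // !rmorphM. Qed.
HB.instance Definition _ :=
  GRing.isMonoidMorphism.Build k weyl weyl_c weyl_c_is_monoid_morphism.

Let qP a b : weyl_rel a b -> q a = q b.
Proof. by move=> ab; apply/qproj_eq/ri_rel. Qed.

Let qM a b : q (a * b) = (q a : weyl) * q b. Proof. exact: rmorphM. Qed.
Let qB a b : q (a - b) = (q a : weyl) - q b. Proof. exact: rmorphB. Qed.

Lemma weyl_cx c e : GRing.comm (weyl_c c) (weyl_x e).
Proof. by rewrite /GRing.comm -!qM; apply: qP; apply: weyl_scal. Qed.
Lemma weyl_cy c e : GRing.comm (weyl_c c) (weyl_y e).
Proof. by rewrite /GRing.comm -!qM; apply: qP; apply: weyl_scal. Qed.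
Lemma weyl_xC e e' : GRing.comm (weyl_x e) (weyl_x e').
Proof.
apply/eqP; rewrite -subr_eq0 -!qM -qB; apply/eqP.
by rewrite (qP (weyl_xx e e')) rmorph0.
Qed.
Lemma weyl_yC e e' : GRing.comm (weyl_y e) (weyl_y e').
Proof.
apply/eqP; rewrite -subr_eq0 -!qM -qB; apply/eqP.
by rewrite (qP (weyl_yy e e')) rmorph0.
Qed.
Lemma weyl_yxB e e' :
  weyl_y e * weyl_x e' - weyl_x e' * weyl_y e = (e == e')%:R.
Proof. by rewrite -!qM -qB (qP (weyl_yx e e')) rmorph_nat. Qed.
Lemma weyl_yxC e e' : e != e' -> GRing.comm (weyl_y e) (weyl_x e').
Proof.
by move=> /negbTE ee; apply/eqP; rewrite -subr_eq0 weyl_yxB ee.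
Qed.

Lemma weyl_uC e e' :
  GRing.comm (weyl_y e * weyl_x e) (weyl_y e' * weyl_x e').
Proof.
have [-> //|ee] := eqVneq e e'; have ee' := ee; rewrite eq_sym in ee'.
apply: commrM; apply: commr_sym; apply: commrM.
- exact: weyl_yC.
- exact: weyl_yxC.
- exact/commr_sym/weyl_yxC.
- exact: weyl_xC.
Qed.

Lemma weyl_cu c e : GRing.comm (weyl_c c) (weyl_y e * weyl_x e).
Proof. by apply: commrM; [apply: weyl_cy|apply: weyl_cx]. Qed.

Definition weyl_rho : polyAlg k E -> weyl :=
  polyEval weyl_c (fun e => weyl_y e * weyl_x e).

HB.instance Definition _ := GRing.Additive.on weyl_rho.
HB.instance Definition _ :=
  GRing.isMonoidMorphism.Build (polyAlg k E) weyl weyl_rho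
    (polyEval_is_monoid_morphism weyl_uC weyl_cu).

Definition weyl_star : weyl -> weyl := qr_star (fr_star (@xy_swap E)).

Let frP := @fr_starP k (xyGen E) (@xy_swap E) (@xy_swapK E).
Let starE := (fr_star_scal, fr_star_gen, involutionM frP, involution_zmod frP).

Lemma weyl_rel_star a b : weyl_rel a b ->
  rel_ideal weyl_rel (fr_star (@xy_swap E) a - fr_star (@xy_swap E) b).
Proof.
move=> ab; apply/qproj_eq; case: ab => [c g|e e'|e e'|e e']; rewrite ?starE.
- exact/esym/qP/weyl_scal.
- exact: (qP (weyl_yy e' e)).
- exact: (qP (weyl_xx e' e)).
- have starn : fr_star (@xy_swap E) (e == e')%:R
      = (e == e')%:R :> freeRing k (xyGen E).
    by case: (e == e'); rewrite ?(involution0 frP) ?(involution1 frP).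
  by rewrite starn eq_sym; exact: (qP (weyl_yx e' e)).
Qed.

Lemma weyl_starP : involution weyl_star.
Proof. exact: (qr_starP frP (rel_ideal_star frP weyl_rel_star)). Qed.
Lemma weyl_star_proj a : weyl_star (q a) = q (fr_star (@xy_swap E) a).
Proof. exact: (qr_star_proj frP (rel_ideal_star frP weyl_rel_star)). Qed.

Lemma weyl_star_c c : weyl_star (weyl_c c) = weyl_c c.
Proof. by rewrite /weyl_c weyl_star_proj fr_star_scal. Qed.
Lemma weyl_star_x e : weyl_star (weyl_x e) = weyl_y e.
Proof. by rewrite /weyl_x weyl_star_proj fr_star_gen. Qed.
Lemma weyl_star_y e : weyl_star (weyl_y e) = weyl_x e.
Proof. by rewrite /weyl_y weyl_star_proj fr_star_gen. Qed.

Lemma weyl_rho_star p : weyl_star (weyl_rho p) = weyl_rho p.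
Proof.
elim/polyAlg_ind: p => [c|e|p p' IHp IHp'|p p' IHp IHp'].
- by rewrite /weyl_rho polyEvalC weyl_star_c.
- rewrite /weyl_rho polyEval_var (involutionM weyl_starP).
  by rewrite weyl_star_x weyl_star_y.
- by rewrite rmorphD (involutionD weyl_starP) IHp IHp'.
- have rM r s : weyl_rho (r * s) = weyl_rho r * weyl_rho s by exact: rmorphM.
  by rewrite [in LHS]rM (involutionM weyl_starP) IHp IHp' -rM mulrC.
Qed.

Definition weylAlg : invRing (polyAlg k E) :=
  InvRing weyl_starP weyl_rho_star.

Definition zgen (e : E) (p : int) : weyl :=
  match p with
  | Posz n => weyl_x e ^+ n
  | Negz n => weyl_y e ^+ n.+1
  end.

(* The order of the factors is irrelevant, as they commute. *)
Definition zpow (d : {malg int[E]}) : weylAlg :=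
  \prod_(e <- msupp d) zgen e d@_e.
End Weyl.

Definition posnat : Type := {n : nat | (0 < n)%N}.

Record multiquiver (V E : Type) : Type := Multiquiver {
  mq_src : E -> option (V * posnat);
  mq_tgt : E -> option (V * posnat);
  mq_noloop : forall e u m v n,
    mq_src e = Some (u, m) -> mq_tgt e = Some (v, n) -> u <> v;
  mq_locfin : forall v, finite_set [set e |
    (exists n, mq_src e = Some (v, n)) \/ (exists n, mq_tgt e = Some (v, n))]
}.

Section Multiquiver.
Variables (V E : choiceType) (G : multiquiver V E).

Definition end_mult (v : V) (o : option (V * posnat)) : nat :=
  if o is Some (w, n) then if w == v then val n else 0%N else 0%N.

(* By [mq_noloop], at most one of the two terms is nonzero. *)
Definition mq_coef (e : E) (v : V) : int :=
  (end_mult v (mq_tgt G e))%:Z - (end_mult v (mq_src G e))%:Z.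

Lemma mq_coef_tgt e v n : mq_tgt G e = Some (v, n) -> mq_coef e v = (val n)%:Z.
Proof.
move=> te; rewrite /mq_coef te /= eqxx; case se: (mq_src G e) => [[u m]|] /=.
  by case: eqP => [/(mq_noloop se te) //|_]; rewrite subr0.
by rewrite subr0.
Qed.

Lemma mq_coef_src e v n :
  mq_src G e = Some (v, n) -> mq_coef e v = - (val n)%:Z.
Proof.
move=> se; rewrite /mq_coef se /= eqxx; case te: (mq_tgt G e) => [[u m]|] /=.
  by case: eqP => [uv|_]; [case: (mq_noloop se te)|rewrite sub0r].
by rewrite sub0r.
Qed.

Lemma mq_coef0 e v : (forall n, mq_src G e <> Some (v, n)) ->
  (forall n, mq_tgt G e <> Some (v, n)) -> mq_coef e v = 0.
Proof.
rewrite /mq_coef /end_mult => ns nt.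
case: (mq_tgt G e) nt => [[u m]|] nt; case: (mq_src G e) ns => [[w n]|] ns //.
- case: eqP nt => [-> /(_ m) //|_ _].
  by case: eqP ns => [-> /(_ n) //|_ _].
- by case: eqP nt => [-> /(_ m) //|_ _].
- by case: eqP ns => [-> /(_ n) //|_ _].
Qed.

Definition mq_incident (v : V) : set E := [set e |
  (exists n, mq_src G e = Some (v, n)) \/ (exists n, mq_tgt G e = Some (v, n))].

Definition mq_col (v : V) : {malg int[E]} :=
  \sum_(e <- fset_set (mq_incident v)) << mq_coef e v *g e >>.

Lemma mq_colE v e : (mq_col v)@_e = mq_coef e v.
Proof.
rewrite /mq_col raddf_sum /=.
under eq_bigr do rewrite mcoeffU.
have [ev|ev] := boolP (e \in fset_set (mq_incident v)).
  rewrite (big_fsetD1 e) //= eqxx big1_fset ?addr0 // => e'.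
  by rewrite !inE => /andP[/negbTE -> _] _.
rewrite big1_fset => [|e' e'v _]; last first.
  by case: eqP ev => // <-; rewrite e'v.
rewrite in_fset_set ?notin_setE in ev; last exact: mq_locfin.
by rewrite mq_coef0 // => n en; apply: ev; [left|right]; exists n.
Qed.

(* The incidence matrix, as a homomorphism ZV -> ZE. *)
Definition incidence (d : {malg int[V]}) : {malg int[E]} :=
  \sum_(v <- msupp d) mq_col v *~ d@_v.

Lemma incidenceEw (s : {fset V}) d : (msupp d `<=` s)%fset ->
  incidence d = \sum_(v <- s) mq_col v *~ d@_v.
Proof.
by move=> le; apply/big_fset_incl => // m _ /mcoeff_outdom ->; rewrite mulr0z.
Qed.

Lemma incidence_is_zmod_morphism : zmod_morphism incidence.
Proof.
move=> p q; pose d := (msupp p `|` msupp q)%fset.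
rewrite !(@incidenceEw d) ?fsubsetUl ?fsubsetUr ?msuppB_le //.
by rewrite -sumrB; apply: eq_bigr => m _; rewrite mcoeffB mulrzBr.
Qed.
HB.instance Definition _ :=
  GRing.isZmodMorphism.Build {malg int[V]} {malg int[E]} incidence
    incidence_is_zmod_morphism.

Lemma incidenceU v : incidence << v >> = mq_col v.
Proof.
rewrite (@incidenceEw [fset v]%fset) ?msuppU_le //.
by rewrite big_seq_fset1 mcoeffUU mulr1z.
Qed.

Lemma incidenceE v e : (incidence << v >>)@_e = mq_coef e v.
Proof. by rewrite incidenceU mq_colE. Qed.

Variable k : fieldType.
Local Notation RE := (polyAlg k E).

Definition mq_sigma (v : V) : {lrmorphism RE -> RE} :=
  polySubst (fun e => pvar k e - (mq_coef e v)%:~R).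
Definition mq_sigmaV (v : V) : RE -> RE :=
  polySubst (fun e => pvar k e + (mq_coef e v)%:~R).

Definition mq_u (e : E) (v : V) : RE :=
  match mq_coef e v with
  | Posz n => \prod_(j < n) (pvar k e + j%:R)
  | Negz n => \prod_(j < n.+1) (pvar k e - j.+1%:R)
  end.

(* [mq_u e v = 1] outside the finite support of [incidence << v >>]. *)
Definition mq_t (v : V) : RE :=
  \prod_(e <- msupp (incidence << v >>)) mq_u e v.

Let ext (f g : {rmorphism RE -> RE}) :
  (forall c, f c%:MP = g c%:MP) -> (forall e, f (pvar k e) = g (pvar k e)) ->
  f =1 g.
Proof. exact: polyAlg_rmorph_ext. Qed.

Lemma mq_sigmaK v : cancel (mq_sigma v) (mq_sigmaV v).
Proof.
apply: (ext (f := polySubst _ \o polySubst _) (g := idfun)) => [c|e] /=.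
  by rewrite !polySubstC.
by rewrite polySubst_var rmorphB rmorph_int /= polySubst_var addrK.
Qed.

Lemma mq_sigmaVK v : cancel (mq_sigmaV v) (mq_sigma v).
Proof.
apply: (ext (f := polySubst _ \o polySubst _) (g := idfun)) => [c|e] /=.
  by rewrite !polySubstC.
by rewrite polySubst_var rmorphD rmorph_int /= polySubst_var subrK.
Qed.

Lemma mq_sigmaC v w p :
  mq_sigma v (mq_sigma w p) = mq_sigma w (mq_sigma v p).
Proof.
move: p; apply: (ext (f := polySubst _ \o polySubst _)
  (g := polySubst _ \o polySubst _)) => [c|e] /=.
  by rewrite !polySubstC.
have sB u p n : mq_sigma u (p - n%:~R) = mq_sigma u p - n%:~R.
  by rewrite rmorphB rmorph_int.
rewrite !polySubst_var -!/(mq_sigma _ _) !sB /= !polySubst_var.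
by rewrite addrAC.
Qed.

Lemma mq_t_neq0 v : mq_t v != 0.
Proof.
pose f : {rmorphism RE -> {poly k}} := polyEval polyC (fun _ => 'X).
have fX e c : f (pvar k e + c%:R) = 'X + c%:R.
  by rewrite rmorphD rmorph_nat /= polyEval_var.
have fXB e c : f (pvar k e - c%:R) = 'X - c%:R.
  by rewrite rmorphB rmorph_nat /= polyEval_var.
suff : f (mq_t v) != 0 by apply: contra_neq => ->; rewrite rmorph0.
rewrite rmorph_prod prodf_seq_neq0; apply/allP => e _ /=.
rewrite /mq_u; case: (mq_coef e v) => n; rewrite rmorph_prod.
  apply/prodf_neq0 => j _; rewrite fX -polyC_natr.
  by rewrite -size_poly_eq0 size_XaddC.
apply/prodf_neq0 => j _; rewrite fXB -polyC_natr.
by rewrite polyXsubC_eq0.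
Qed.

Definition mq_datum : tgwDatum V RE := {|
  tgw_sigma := mq_sigma;
  tgw_sigmaV := mq_sigmaV;
  tgw_sigmaK := mq_sigmaK;
  tgw_sigmaVK := mq_sigmaVK;
  tgw_sigmaC := mq_sigmaC;
  tgw_t := mq_t;
  tgw_t_neq0 := mq_t_neq0;
  tgw_t_central := fun v r => mulrC (mq_t v) r
|}.

Definition mq_mu : tgwMu k V :=
  TgwMu (tgw_mu := fun _ _ => 1) (fun _ _ _ => oner_neq0 k).

Lemma mq_muC i j : mq_mu i j = mq_mu j i. Proof. by []. Qed.

Definition mqAlg : invRing RE :=
  @InvRing RE (tgwA mq_datum mq_mu) (tgwA_rho mq_datum mq_mu)
    (@tgwA_star k V RE mq_datum mq_mu)
    (tgwA_starP mq_datum mq_muC) (tgwA_star_rho mq_datum mq_muC).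

Definition mqX (v : V) : mqAlg := tgwA_X mq_datum mq_mu v.
Definition mqY (v : V) : mqAlg := tgwA_Y mq_datum mq_mu v.
End Multiquiver.

(* Main.v *)
(** The Weyl algebra acts on k[u_e]: x_e by the shift u_e |-> u_e - 1 and y_e by
    the inverse shift followed by multiplication by u_e.  Hence rho is injective
    and every monomial z^d acts injectively.  Since z^d is, up to elements of
    k[u_e], multiplicative in d, and shifts k[u_e] by d, the defining relations
    of the TGW construction hold for the monomials z^(gamma v), and the
    resulting map sends elements of degree d to elements rho(r) z^(gamma d).
    If K is a graded ideal meeting degree zero trivially and a in K is
    homogeneous with image w = rho(r) z^(gamma d), then a a^* = 0, so
    0 = w w^* = z^(gamma d) z^(- gamma d) rho(r^2).  Thus r^2 = 0, and r = 0
    because k[u_e] is reduced; so the map factors through the quotient. *)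
From HB Require Import structures.
Require Import Defs.
From mathcomp Require Import all_boot all_order all_algebra.
From mathcomp Require Import monalg.
From mathcomp Require Import finmap boolp zify.

Set Implicit Arguments.
Unset Strict Implicit.
Unset Printing Implicit Defensive.

Import GRing.Theory.

Local Open Scope ring_scope.

(** * Polynomials *)

Section PolyAlgTheory.
Variables (k : fieldType) (E : choiceType).
Implicit Types (m : {cmonom E}) (p q : polyAlg k E).

Lemma mulcmI m : injective (mmul m).
Proof.
move=> m1 m2 /eqP/cmP eq12; apply/eqP/cmP => e.
by have := eq12 e; rewrite !cmM => /addnI.
Qed.

Lemma mcoeff_pvarM e p m : (pvar k e * p)@_(mmul (ucm e) m) = p@_m.
Proof.
rewrite malgM_def fgmulUg raddf_sum /=.
under eq_bigr do rewrite mul1r mcoeffU (inj_eq (@mulcmI _)).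
have [mp|mp] := boolP (m \in msupp p).
  rewrite (big_fsetD1 m) //= eqxx big1_fset ?addr0 // => m'.
  by rewrite in_fsetD1 => /andP[/negbTE -> _] _.
rewrite big1_fset ?(mcoeff_outdom mp) // => m' m'p _.
by case: eqP mp => // <-; rewrite m'p.
Qed.

(** Multiplying by a variable only translates the coefficients. This is the multiplication part of
    the injectivity of the action of [y_e]. *)
Lemma pvarM_eq0 e p : pvar k e * p = 0 -> p = 0.
Proof.
move=> ep0; apply/malgP => m.
by rewrite -(mcoeff_pvarM e) ep0 !mcoeff0.
Qed.

(** The squared Euclidean norm of the exponent vector. By strict convexity, a maximizer [m] on a
    finite set of monomials is the midpoint of no two others, which singles out a monomial without
    ordering the variables. *)
Definition sqnorm m : nat := (\sum_(e <- finsupp m) m e ^ 2)%N.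

Lemma sqnormEw (d : {fset E}) m : (finsupp m `<=` d)%fset ->
  sqnorm m = (\sum_(e <- d) m e ^ 2)%N.
Proof.
move=> le; apply/big_fset_incl => // e _.
by rewrite -cmE_eq0 => /eqP ->.
Qed.

(* The parallelogram law for [m1 = m + d], [m2 = m - d] gives [d = 0]. *)
Lemma sqnorm_max_extremal m m1 m2 : mmul m1 m2 = mmul m m ->
  (sqnorm m1 <= sqnorm m)%N -> (sqnorm m2 <= sqnorm m)%N -> m1 = m.
Proof.
move=> /eqP/cmP mE.
pose d := (finsupp m `|` finsupp m1 `|` finsupp m2)%fset.
have le0 : (finsupp m `<=` d)%fset by rewrite /d -fsetUA fsubsetUl.
have le1 : (finsupp m1 `<=` d)%fset.
  by rewrite /d [X in (X `|` _)%fset]fsetUC -fsetUA fsubsetUl.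
have le2 : (finsupp m2 `<=` d)%fset by rewrite fsubsetUr.
rewrite (sqnormEw le0) (sqnormEw le1) (sqnormEw le2).
(* With truncated subtraction one summand is always zero, so this is the absolute difference. *)
pose dist e := ((m1 e - m e) + (m e - m1 e))%N.
have par e : (m1 e ^ 2 + m2 e ^ 2 = 2 * m e ^ 2 + 2 * dist e ^ 2)%N.
  have := mE e; rewrite !cmM /dist -!mulnn.
  move: (m1 e) (m2 e) (m e) => a b c abc.
  have [ac|ca] := leqP a c.
    have [j cE] : exists j, c = (a + j)%N by exists (c - a)%N; lia.
    have -> : b = (a + 2 * j)%N by lia.
    rewrite cE; have -> : (a - (a + j) + (a + j - a) = j)%N by lia.
    lia.
  have [j aE] : exists j, a = (c + j)%N by exists (a - c)%N; lia.
  have cE : c = (b + j)%N by lia.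
  rewrite aE; have -> : (c + j - c + (c - (c + j)) = j)%N by lia.
  by rewrite cE; lia.
have : (\sum_(e <- d) m1 e ^ 2 + \sum_(e <- d) m2 e ^ 2
    = 2 * \sum_(e <- d) m e ^ 2 + 2 * \sum_(e <- d) dist e ^ 2)%N.
  by rewrite -big_split !big_distrr -big_split /=; apply: eq_bigr => e _.
move=> sE s1 s2; have s0 : (\sum_(e <- d) dist e ^ 2 = 0)%N by lia.
apply/eqP/cmP => e; have [ed|] := boolP (e \in d); last first.
  rewrite !inE !negb_or -!cmE_eq0 => /andP[/andP[/eqP -> /eqP ->] _] //.
move/eqP: s0; rewrite sum_nat_seq_eq0 => /allP/(_ e ed) /=.
by rewrite expn_eq0 /dist addn_eq0 => /andP[/andP[le10 le01] _]; lia.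
Qed.

(** If [m] has maximal [sqnorm] in the support, then [mmul m m] arises from the pair [(m, m)] only,
    so its coefficient in [p * p] is the square of a nonzero scalar. *)
Lemma polyAlg_reduced p : p * p = 0 -> p = 0.
Proof.
move=> pp0; apply/eqP/negPn/negP => p0.
have /fset0Pn[m0 m0p] : msupp p != fset0 by rewrite msupp_eq0.
pose i0 : msupp p := [` m0p]%fset.
case: (@arg_maxnP _ i0 xpredT (fun i : msupp p => sqnorm (val i))) => //.
move=> i _ imax; set m := val i.
have mmax m' : m' \in msupp p -> (sqnorm m' <= sqnorm m)%N.
  by move=> m'p; apply: (imax [` m'p]%fset).
have mp : m \in msupp p by apply: valP.
have : (p * p)@_(mmul m m) = p@_m * p@_m.
  rewrite mcoeffMl (big_fsetD1 m) //= (big_fsetD1 m) //= eqxx mulr1n.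
  rewrite big1_fset => [|m2]; last first.
    rewrite in_fsetD1 => /andP[/negbTE m2m m2p] _.
    by rewrite (inj_eq (@mulcmI _)) m2m.
  rewrite addr0 big1_fset ?addr0 // => m1.
  rewrite in_fsetD1 => /andP[/eqP m1m m1p] _; rewrite big1_fset // => m2 m2p _.
  case: eqP => // m12; case: m1m.
  exact: sqnorm_max_extremal m12 (mmax _ m1p) (mmax _ m2p).
by rewrite pp0 mcoeff0 => /esym/eqP; rewrite mulf_eq0 orbb mcoeff_eq0 mp.
Qed.
End PolyAlgTheory.

(* Variables and shifts are locked, as unification otherwise unfolds them down
   to finitely supported functions when rewriting with ring identities. *)
HB.lock Definition uvar (k : fieldType) (E : choiceType) (e : E) :
  polyAlg k E := pvar k e.
Arguments uvar k {E} e.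

Lemma uvarE (k : fieldType) (E : choiceType) (e : E) : pvar k e = uvar k e.
Proof. by rewrite unlock. Qed.

HB.lock Definition pshift (k : fieldType) (E : choiceType) (d : E -> int)
    (p : polyAlg k E) : polyAlg k E :=
  polySubst (fun e => uvar k e - (d e)%:~R) p.
Arguments pshift k {E} d p.

(** * Shift automorphisms of the polynomial algebra *)

Section PolyShift.
Variables (k : fieldType) (E : choiceType).
Implicit Types (d : E -> int) (p : polyAlg k E).
Local Notation pshift := (pshift k).

Lemma pshift_is_zmod_morphism d : zmod_morphism (pshift d).
Proof. by move=> p q; rewrite unlock rmorphB. Qed.
HB.instance Definition _ d :=
  GRing.isZmodMorphism.Build (polyAlg k E) (polyAlg k E) (pshift d)
    (pshift_is_zmod_morphism d).
Lemma pshift_is_monoid_morphism d : monoid_morphism (pshift d).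
Proof. by split=> [|p q]; rewrite unlock ?rmorph1 ?rmorphM. Qed.
HB.instance Definition _ d :=
  GRing.isMonoidMorphism.Build (polyAlg k E) (polyAlg k E) (pshift d)
    (pshift_is_monoid_morphism d).

Lemma pshiftC d c : pshift d c%:MP = c%:MP.
Proof. by rewrite unlock polySubstC. Qed.

Lemma pshift_var d e : pshift d (uvar k e) = uvar k e - (d e)%:~R.
Proof. by rewrite -[X in pshift d X]uvarE unlock polySubst_var. Qed.

Lemma pshift_var_id d e : d e = 0 -> pshift d (uvar k e) = uvar k e.
Proof. by move=> de; rewrite pshift_var de subr0. Qed.

Lemma pshiftD d : {morph pshift d : p q / p + q}.
Proof. exact: rmorphD. Qed.

Lemma pshiftM d : {morph pshift d : p q / p * q}.
Proof. exact: rmorphM. Qed.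

Lemma pshift_eq d d' : d =1 d' -> pshift d =1 pshift d'.
Proof. by move=> /funext ->. Qed.

Lemma pshift_comp d d' p :
  pshift d (pshift d' p) = pshift (fun e => d e + d' e) p.
Proof.
move: p; apply: (polyAlg_rmorph_ext (f := pshift d \o pshift d')) => [c|e] /=.
  by rewrite !pshiftC.
rewrite uvarE !pshift_var rmorphB rmorph_int /= pshift_var rmorphD.
by rewrite opprD addrA.
Qed.

Lemma pshift0 p : pshift (fun=> 0) p = p.
Proof.
move: p; apply: (polyAlg_rmorph_ext (g := idfun)) => [c|e] /=.
  by rewrite pshiftC.
by rewrite uvarE pshift_var subr0.
Qed.

Lemma pshift_eq0 d p : pshift d p = 0 -> p = 0.
Proof.
move=> dp0; rewrite -[p]pshift0 -(@pshift_eq (fun e => - d e + d e)).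
  by rewrite -pshift_comp dp0 rmorph0.
by move=> e; rewrite addNr.
Qed.
End PolyShift.

(** * Rings *)

(** In the induction [H x] moves left past the factors [F y] with [y] different from [x]. The
    hypothesis is restricted to distinct indices because powers of [x_e] and [y_e] with the same [e]
    do not commute. *)
Lemma prodrM_disjoint_comm (B : pzRingType) (T : eqType) (F H : T -> B)
    (s : seq T) :
  uniq s -> (forall x y, x != y -> GRing.comm (F x) (H y)) ->
  \prod_(x <- s) F x * \prod_(x <- s) H x = \prod_(x <- s) (F x * H x).
Proof.
move=> + FH; elim: s => [|x s IHs]; first by rewrite !big_nil mulr1.
case/andP=> xs us; rewrite !big_cons -(IHs us) -!mulrA; congr (_ * _).
rewrite !mulrA; congr (_ * _); apply: commr_sym; rewrite big_seq.
apply: commr_prod => y ys; apply/commr_sym/FH.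
by apply: contraNneq xs => <-.
Qed.

Lemma quotRing_lift (A B : pzRingType) (J : ideal A) (f : {rmorphism A -> B}) :
  (forall a, J a -> f a = 0) ->
  exists g : {rmorphism quotRing J -> B}, forall a, g (qproj J a) = f a.
Proof.
move=> fJ; pose g (x : quotRing J) : B := f (repr x).
have gE a : g (qproj J a) = f a.
  by apply/eqP; rewrite -subr_eq0 -rmorphB; apply/eqP/fJ/qproj_eq/reprK.
have gB : zmod_morphism g.
  move=> x y; have [a ->] := qproj_surj x; have [b ->] := qproj_surj y.
  by rewrite -rmorphB !gE rmorphB.
have gM : monoid_morphism g.
  split=> [|x y]; first by rewrite -(rmorph1 (qproj J)) gE rmorph1.
  have [a ->] := qproj_surj x; have [b ->] := qproj_surj y.
  by rewrite -rmorphM !gE rmorphM.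
pose gz := GRing.isZmodMorphism.Build _ _ g gB.
pose gm := GRing.isMonoidMorphism.Build _ _ g gM.
pose gr : {rmorphism quotRing J -> B} := HB.pack g gz gm.
by exists gr.
Qed.

Lemma rel_ideal_ker (A B : pzRingType) (rel : A -> A -> Prop)
    (f : {rmorphism A -> B}) :
  (forall a b, rel a b -> f a = f b) -> forall a, rel_ideal rel a -> f a = 0.
Proof.
move=> frel a; elim=> {a} [a b /frel ab||a b _ fa _ fb|c a _ fa|c a _ fa].
- by rewrite rmorphB ab subrr.
- exact: rmorph0.
- by rewrite rmorphD fa fb addr0.
- by rewrite rmorphM fa mulr0.
- by rewrite rmorphM fa mul0r.
Qed.

(** * The ring of additive endomorphisms of an abelian group *)

Section AdditiveEndomorphisms.
Variable M : zmodType.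

(** The target of the action of the Weyl algebra: as it is a ring, the universal properties of the
    free ring and of the quotient produce the action. *)
Record addEnd : Type := AddEnd {
  addEnd_fun :> M -> M;
  addEndB : forall x y, addEnd_fun (x - y) = addEnd_fun x - addEnd_fun y
}.

HB.instance Definition _ := gen_eqMixin addEnd.
HB.instance Definition _ := gen_choiceMixin addEnd.

Lemma addEndP (f g : addEnd) : f =1 g -> f = g.
Proof.
case: f g => [f fB] [g gB] /= /funext fg; case: _ / fg in gB *.
by congr AddEnd; apply: Prop_irrelevance.
Qed.

Lemma addEnd0 (f : addEnd) : f 0 = 0.
Proof. by rewrite -[in LHS](subrr 0) addEndB subrr. Qed.

Lemma addEndD (f : addEnd) x y : f (x + y) = f x + f y.
Proof.
by rewrite -[in LHS](opprK y) addEndB -(sub0r y) addEndB addEnd0 sub0r opprK.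
Qed.

Definition addEnd_zero := @AddEnd (fun=> 0) (fun _ _ => esym (subrr 0)).

Lemma addEnd_add_subproof (f g : addEnd) x y :
  f (x - y) + g (x - y) = f x + g x - (f y + g y).
Proof. by rewrite !addEndB opprD addrACA. Qed.
Definition addEnd_add f g := AddEnd (addEnd_add_subproof f g).

Lemma addEnd_opp_subproof (f : addEnd) x y : - f (x - y) = - f x - - f y.
Proof. by rewrite addEndB opprD. Qed.
Definition addEnd_opp f := AddEnd (addEnd_opp_subproof f).

Definition addEnd_one := @AddEnd id (fun _ _ => erefl).

Lemma addEnd_mul_subproof (f g : addEnd) x y :
  f (g (x - y)) = f (g x) - f (g y).
Proof. by rewrite !addEndB. Qed.
Definition addEnd_mul f g := AddEnd (addEnd_mul_subproof f g).

Let addA : associative addEnd_add.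
Proof. by move=> f g h; apply: addEndP => x /=; rewrite addrA. Qed.
Let addC : commutative addEnd_add.
Proof. by move=> f g; apply: addEndP => x /=; rewrite addrC. Qed.
Let add0 : left_id addEnd_zero addEnd_add.
Proof. by move=> f; apply: addEndP => x /=; rewrite add0r. Qed.
Let addN : left_inverse addEnd_zero addEnd_opp addEnd_add.
Proof. by move=> f; apply: addEndP => x /=; rewrite addNr. Qed.
HB.instance Definition _ := GRing.isZmodule.Build addEnd addA addC add0 addN.

Let mulA : associative addEnd_mul.
Proof. by move=> f g h; apply: addEndP. Qed.
Let mul1x : left_id addEnd_one addEnd_mul.
Proof. by move=> f; apply: addEndP. Qed.
Let mulx1 : right_id addEnd_one addEnd_mul.
Proof. by move=> f; apply: addEndP. Qed.
Let mulDl : left_distributive addEnd_mul +%R.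
Proof. by move=> f g h; apply: addEndP. Qed.
Let mulDr : right_distributive addEnd_mul +%R.
Proof. by move=> f g h; apply: addEndP => x /=; rewrite addEndD. Qed.
HB.instance Definition _ :=
  GRing.Zmodule_isPzRing.Build addEnd mulA mul1x mulx1 mulDl mulDr.

Lemma addEnd_mulE (f g : addEnd) x : (f * g) x = f (g x).
Proof. by []. Qed.
End AdditiveEndomorphisms.

(** * The Weyl algebra *)

HB.lock Definition urho (k : fieldType) (E : choiceType) (r : polyAlg k E) :
  weyl k E := weyl_rho r.

Lemma urhoE (k : fieldType) (E : choiceType) (r : polyAlg k E) :
  weyl_rho r = urho r.
Proof. by rewrite unlock. Qed.

Section WeylTheory.
Variables (k : fieldType) (E : choiceType).
Implicit Types (e : E) (r f : polyAlg k E).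

Local Notation RE := (polyAlg k E).
Local Notation x := (@weyl_x k E).
Local Notation y := (@weyl_y k E).
Local Notation rho := (@urho k E).

Lemma rhoD : {morph rho : p q / p + q}.
Proof. by move=> p q; rewrite -!urhoE; apply: rmorphD. Qed.
Lemma rhoB : {morph rho : p q / p - q}.
Proof. by move=> p q; rewrite -!urhoE; apply: rmorphB. Qed.
Lemma rhoM : {morph rho : p q / p * q}.
Proof. by move=> p q; rewrite -!urhoE; apply: rmorphM. Qed.
Lemma rho1 : rho 1 = 1.
Proof. by rewrite -urhoE; apply: rmorph1. Qed.
Lemma rho_int (n : int) : rho n%:~R = n%:~R.
Proof. by rewrite -urhoE; apply: rmorph_int. Qed.
Lemma rho_const c : rho c%:MP = weyl_c E c.
Proof. by rewrite -urhoE; apply: polyEvalC. Qed.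
Lemma rho_var e : rho (uvar k e) = y e * x e.
Proof. by rewrite -urhoE -uvarE; apply: polyEval_var. Qed.

Definition unit_deg e (n : int) : E -> int :=
  fun e' => if e == e' then n else 0.

Definition mul_end r : addEnd RE := AddEnd (mulrBr r).

Definition const_end (c : k) : addEnd RE := mul_end c%:MP.

Lemma const_end_is_zmod_morphism : zmod_morphism const_end.
Proof. by move=> a b; apply: addEndP => f /=; rewrite rmorphB mulrBl. Qed.
HB.instance Definition _ :=
  GRing.isZmodMorphism.Build k (addEnd RE) const_end const_end_is_zmod_morphism.
Lemma const_end_is_monoid_morphism : monoid_morphism const_end.
Proof.
split=> [|a b]; apply: addEndP => f /=; first by rewrite rmorph1 mul1r.
by rewrite rmorphM mulrA.
Qed.
HB.instance Definition _ :=
  GRing.isMonoidMorphism.Build k (addEnd RE) const_end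
    const_end_is_monoid_morphism.

Definition shift_end (d : E -> int) : addEnd RE :=
  @AddEnd RE (pshift k d) (rmorphB (pshift k d)).

Definition weyl_gen_end (g : xyGen E) : addEnd RE :=
  match g with
  | GX e => shift_end (unit_deg e 1)
  | GY e => mul_end (uvar k e) * shift_end (unit_deg e (- 1))
  end.

Let eq_mulr_cancel (A : pzRingType) (a b a' b' c : A) :
  a * b = a' * b' -> a * (b * c) = a' * (b' * c).
Proof. by rewrite !mulrA => ->. Qed.

Let mulrB_pred (A : pzRingType) (a b : A) : a * b - (a - 1) * b = b.
Proof. by rewrite -mulrBl opprB addrCA subrr addr0 mul1r. Qed.

(* [k[u_e]] is a module: [x_e] acts as the shift [u_e |-> u_e - 1], and [y_e] as
   its inverse followed by multiplication by [u_e], so that [y_e x_e] acts as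
   multiplication by [u_e]. *)
Lemma weyl_action : exists theta : {rmorphism weyl k E -> addEnd RE},
  [/\ forall r f, theta (rho r) f = r * f,
      forall e f, theta (x e) f = pshift k (unit_deg e 1) f
    & forall e f, theta (y e) f = uvar k e * pshift k (unit_deg e (- 1)) f].
Proof.
have shiftC d d' f : pshift k d (pshift k d' f) = pshift k d' (pshift k d f).
  by rewrite !pshift_comp; apply: pshift_eq => e; rewrite addrC.
have shiftK e n f : pshift k (unit_deg e n) (pshift k (unit_deg e (- n)) f) = f.
  rewrite pshift_comp -[RHS]pshift0; apply: pshift_eq => e'.
  by rewrite /unit_deg; case: eqP => _; rewrite ?subrr ?addr0.
have shift_other e e' n : e != e' ->
    pshift k (unit_deg e n) (uvar k e') = uvar k e'.
  by move=> ee'; apply: pshift_var_id; rewrite /unit_deg (negbTE ee').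
have [|theta thetaE] := @quotRing_lift _ _ (rel_ideal (@weyl_rel k E))
    (flift const_end weyl_gen_end).
  apply: rel_ideal_ker => a b [c g|e e'|e e'|e e'].
  - rewrite !rmorphM /= !flift_scal !flift_gen; apply: addEndP => f.
    case: g => e.
      change (c%:MP * pshift k (unit_deg e 1) f
        = pshift k (unit_deg e 1) (c%:MP * f)).
      by rewrite pshiftM pshiftC.
    change (c%:MP * (uvar k e * pshift k (unit_deg e (- 1)) f)
      = uvar k e * pshift k (unit_deg e (- 1)) (c%:MP * f)).
    by rewrite pshiftM pshiftC; apply: mulrCA.
  - rewrite rmorphB !rmorphM /= !flift_gen rmorph0.
    by apply/eqP; rewrite subr_eq0; apply/eqP/addEndP => f; apply: shiftC.
  - rewrite rmorphB !rmorphM /= !flift_gen rmorph0.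
    apply/eqP; rewrite subr_eq0; apply/eqP/addEndP => f.
    pose s e := pshift k (unit_deg e (- 1)).
    change (uvar k e * s e (uvar k e' * s e' f)
      = uvar k e' * s e' (uvar k e * s e f)).
    rewrite /s; have [-> //|ee'] := eqVneq e e'.
    have e'e : e' != e by rewrite eq_sym.
    rewrite !pshiftM [pshift k _ (pshift k _ f)]shiftC.
    rewrite (shift_other _ _ _ ee') (shift_other _ _ _ e'e).
    exact/eq_mulr_cancel/mulrC.
  - rewrite rmorphB !rmorphM /= !flift_gen rmorph_nat; apply: addEndP => f.
    pose s e n := pshift k (unit_deg e n).
    change (uvar k e * s e (- 1) (s e' 1 f) - s e' 1 (uvar k e * s e (- 1) f)
      = ((e == e')%:R : addEnd RE) f).
    rewrite /s pshiftM [pshift k (unit_deg e (- 1)) (pshift k _ f)]shiftC.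
    have [<-|ee'] := eqVneq e e'; last first.
      have e'e : e' != e by rewrite eq_sym.
      by rewrite (shift_other _ _ _ e'e); apply: subrr.
    (* At equal indices the two shifts cancel and the commutator acts as
       [u_e f - (u_e - 1) f = f]. *)
    by rewrite !shiftK pshift_var /unit_deg eqxx; apply: mulrB_pred.
exists theta; split=> [r f|e f|e f]; last 2 first.
- by rewrite thetaE /= flift_gen.
- by rewrite thetaE /= flift_gen.
move: r f; apply: polyAlg_ind => [c|e|p q IHp IHq|p q IHp IHq] f.
- by rewrite rho_const thetaE /= flift_scal.
- rewrite uvarE rho_var rmorphM addEnd_mulE.
  rewrite !thetaE /= !flift_gen /=; congr (_ * _).
  by rewrite -{1}(opprK 1) shiftK.
- by rewrite rhoD rmorphD mulrDl -IHp -IHq.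
- by rewrite rhoM rmorphM addEnd_mulE IHq IHp mulrA.
Qed.

Lemma weyl_xyE e : x e * y e = rho (uvar k e - 1).
Proof.
rewrite rhoB rho_var rho1; have := weyl_yxB k e e; rewrite eqxx mulr1n.
by move=> <-; rewrite opprB addrCA subrr addr0.
Qed.

(* [z] is of degree [d] for the grading of the Weyl algebra. *)
Definition has_shift (z : weyl k E) (d : E -> int) : Prop :=
  forall r, z * rho r = rho (pshift k d r) * z.

Lemma has_shift1 : has_shift 1 (fun=> 0).
Proof. by move=> r; rewrite pshift0 mulr1 mul1r. Qed.

Lemma has_shift_eq z d d' : d =1 d' -> has_shift z d -> has_shift z d'.
Proof. by move=> /funext ->. Qed.

Lemma has_shiftM z z' d d' : has_shift z d -> has_shift z' d' ->
  has_shift (z * z') (fun e => d e + d' e).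
Proof. by move=> zd zd' r; rewrite -mulrA zd' mulrA zd -pshift_comp mulrA. Qed.

(** The relation [z rho(r) = rho(shift r) z] is preserved by sums and products in [r], so constants
    and variables suffice. *)
Lemma has_shift_gen z d : (forall c, GRing.comm z (weyl_c E c)) ->
  (forall e, z * (y e * x e) = (y e * x e - (d e)%:~R) * z) -> has_shift z d.
Proof.
move=> zc zu; apply: polyAlg_ind => [c|e|p q IHp IHq|p q IHp IHq].
- by rewrite pshiftC rho_const zc.
- by rewrite uvarE pshift_var rhoB rho_int rho_var zu.
- by rewrite pshiftD !rhoD mulrDr mulrDl IHp IHq.
- transitivity (z * (rho p * rho q)); first by congr (z * _); apply: rhoM.
  transitivity (rho (pshift k d p) * rho (pshift k d q) * z); last first.
    by rewrite pshiftM; congr (_ * z); apply/esym/rhoM.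
  by rewrite mulrA IHp -mulrA IHq mulrA.
Qed.

Lemma has_shift_x e : has_shift (x e) (unit_deg e 1).
Proof.
apply: has_shift_gen => [c|e']; first exact/commr_sym/weyl_cx.
rewrite /unit_deg; have [<-|ee'] := eqVneq e e'; last first.
  rewrite subr0; apply: commrM; last exact: weyl_xC.
  by apply/commr_sym/weyl_yxC; rewrite eq_sym.
by rewrite mulrA weyl_xyE rhoB rho_var rho1.
Qed.

Lemma has_shift_y e : has_shift (y e) (unit_deg e (- 1)).
Proof.
apply: has_shift_gen => [c|e']; first exact/commr_sym/weyl_cy.
rewrite /unit_deg; have [<-|ee'] := eqVneq e e'; last first.
  by rewrite subr0; apply: commrM; [apply: weyl_yC|apply: weyl_yxC].
(* Replacing the inner [y x] by [x y + 1] gives [y (y x) = (y x + 1) y]. *)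
have := weyl_xyE e; rewrite rhoB rho_var rho1 => /eqP.
rewrite eq_sym subr_eq => /eqP yxE; rewrite [in LHS]yxE rmorphN opprK.
by rewrite mulrDr mulr1 mulrA mulrDl mul1r.
Qed.

Lemma has_shift_zgen e n : has_shift (zgen k e n) (unit_deg e n).
Proof.
have pow (z : weyl k E) (s : int) m : has_shift z (unit_deg e s) ->
    has_shift (z ^+ m) (unit_deg e (s *+ m)).
  move=> zs; elim: m => [|m IHm].
    by apply: has_shift_eq has_shift1 => e'; rewrite /unit_deg if_same.
  rewrite exprS mulrS; apply: has_shift_eq (has_shiftM zs IHm) => e'.
  by rewrite /unit_deg; case: eqP; rewrite ?addr0.
case: n => n; first by have := pow _ _ n (has_shift_x e); rewrite natz.
by have := pow _ _ n.+1 (has_shift_y e); rewrite mulNrn natz -NegzE.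
Qed.

Lemma zgen_comm e e' n n' : e != e' -> GRing.comm (zgen k e n) (zgen k e' n').
Proof.
move=> ee'; have e'e : e' != e by rewrite eq_sym.
case: n n' => n [] n' /=; apply/commrX/commr_sym/commrX/commr_sym.
- exact: weyl_xC.
- exact/commr_sym/weyl_yxC.
- exact: weyl_yxC.
- exact: weyl_yC.
Qed.

Lemma zgen_comm_pos e (m n : nat) : GRing.comm (zgen k e m) (zgen k e n).
Proof. exact/commrX/commr_sym/commrX. Qed.

Lemma zgen_opp_nat e (n : nat) : zgen k e (- n%:Z) = y e ^+ n.
Proof. by case: n. Qed.

Lemma zgen_comm_neg e (m n : nat) :
  GRing.comm (zgen k e (- m%:Z)) (zgen k e (- n%:Z)).
Proof. by rewrite !zgen_opp_nat; exact/commrX/commr_sym/commrX. Qed.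

Lemma weyl_star_zgen e n : weyl_star (zgen k e n) = zgen k e (- n).
Proof.
have starX (z : weyl k E) m : weyl_star (z ^+ m) = weyl_star z ^+ m.
  elim: m => [|m IHm]; first by rewrite (involution1 (weyl_starP k E)).
  by rewrite exprS (involutionM (weyl_starP k E)) IHm -exprSr.
case: n => n; first by rewrite /= starX weyl_star_x zgen_opp_nat.
by rewrite NegzE opprK /= starX weyl_star_y.
Qed.

(** The factor [u_ev] of [t_v], with an arbitrary integer in place of [gamma_ev]. *)
Definition zfactor e (n : int) : RE :=
  match n with
  | Posz n => \prod_(j < n) (uvar k e + j%:R)
  | Negz n => \prod_(j < n.+1) (uvar k e - j.+1%:R)
  end.

Let subN_subS (A : pzRingType) (a : A) m :
  a - (- m%:Z)%:~R - m.+1%:R = a - 1.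
Proof. by rewrite mulrNz opprK -pmulrn -natr1 opprD addrA addrK. Qed.

(** The innermost pair is [y_e x_e = u_e] or [x_e y_e = u_e - 1]. Carried to the right through the
    remaining power, it is shifted into the last factor of the product. *)
Lemma zgenN_zgen e n : zgen k e (- n) * zgen k e n = rho (zfactor e n).
Proof.
have yx m : y e ^+ m * x e ^+ m = rho (\prod_(j < m) (uvar k e + j%:R)).
  elim: m => [|m IHm]; first by rewrite big_ord0 rho1 mulr1.
  rewrite exprSr exprS mulrA -[_ * y e * x e]mulrA -rho_var big_ord_recr /=.
  have := has_shift_zgen e m (uvar k e + m%:R).
  rewrite rmorphD rmorph_nat /= pshift_var /unit_deg eqxx subrK /= => xm.
  by rewrite -mulrA -xm mulrA IHm -rhoM.
have xy m : x e ^+ m * y e ^+ m = rho (\prod_(j < m) (uvar k e - j.+1%:R)).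
  elim: m => [|m IHm]; first by rewrite big_ord0 rho1 mulr1.
  rewrite exprSr exprS mulrA -[_ * x e * y e]mulrA weyl_xyE big_ord_recr /=.
  (* The power [y_e ^+ m] adds [m] to [u_e], so [u_e - (m + 1)] on its right becomes the inner
     [u_e - 1] on its left. *)
  have := has_shift_zgen e (- m%:Z) (uvar k e - m.+1%:R).
  rewrite zgen_opp_nat rmorphB rmorph_nat /= pshift_var /unit_deg eqxx.
  by rewrite subN_subS -mulrA => <-; rewrite mulrA IHm -rhoM.
case: n => n; first by rewrite zgen_opp_nat yx.
by rewrite NegzE opprK /= xy.
Qed.

Let subS_add (A : pzRingType) (a : A) n (j : 'I_n.+1) :
  a - n.+1%:Z%:~R + j%:R = a - (n.+1 - j.+1).+1%:R.
Proof.
have -> : ((n.+1 - j.+1).+1 = n.+1 - j)%N by have := ltn_ord j; lia.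
by rewrite natrB 1?ltnW // opprB -pmulrn addrA addrAC.
Qed.

Let subNegz_subS (A : pzRingType) (a : A) n (j : 'I_n.+1) :
  a - (Negz n)%:~R - j.+1%:R = a + (n.+1 - j.+1)%:R.
Proof. by rewrite natrB // NegzE mulrNz opprK -pmulrn addrA. Qed.

(** Shifting [u (u + 1) ... (u + n - 1)] by [n] gives [(u - n) ... (u - 1)], the other kind of
    product read backwards; hence the reindexing by reversal. The negative case is symmetric. *)
Lemma zfactor_shift e n d : d e = n ->
  pshift k d (zfactor e n) = zfactor e (- n).
Proof.
move=> de; case: n de => n de; rewrite /= rmorph_prod.
  case: n de => [|n] de /=; first by rewrite !big_ord0.
  rewrite [RHS](reindex_inj rev_ord_inj) /=; apply: eq_bigr => j _.
  by rewrite rmorphD rmorph_nat /= pshift_var de; apply: subS_add.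
rewrite [RHS](reindex_inj rev_ord_inj) /=; apply: eq_bigr => j _.
by rewrite rmorphB rmorph_nat /= pshift_var de; apply: subNegz_subS.
Qed.

(** The right factor is absorbed one letter at a time. A letter either lengthens the power or meets
    its opposite, leaving a polynomial in [u_e] that moves to the left. *)
Lemma zgen_zgen e m n :
  exists r, zgen k e m * zgen k e n = rho r * zgen k e (m + n).
Proof.
pose deg (z : weyl k E) (i : int) := exists r, z = rho r * zgen k e i.
have degM z i r : deg z i -> deg (z * rho r) i.
  case=> r' ->; rewrite -mulrA has_shift_zgen mulrA -rhoM.
  by eexists.
have degl r z i : deg z i -> deg (rho r * z) i.
  by case=> r' ->; rewrite mulrA -rhoM; eexists.
have deg_z i : deg (zgen k e i) i by exists 1; rewrite rho1 mul1r.
have degx z i : deg z i -> deg (z * x e) (i + 1).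
  case=> r ->; rewrite -mulrA; apply: degl.
  case: i => i; first by rewrite -PoszD addn1 /= -exprSr; apply: (deg_z i.+1).
  rewrite /= exprSr -mulrA -rho_var; apply: degM.
  have -> : Negz i + 1 = - i%:Z by lia.
  by rewrite -zgen_opp_nat; apply: deg_z.
have degy z i : deg z i -> deg (z * y e) (i - 1).
  case=> r ->; rewrite -mulrA; apply: degl.
  case: i => [[|i]|i].
  - by rewrite mul1r sub0r; apply: (deg_z (- 1)).
  - rewrite /= exprSr -mulrA weyl_xyE; apply: degM.
    have -> : i.+1%:Z - 1 = i%:Z by lia.
    exact: (deg_z i).
  - have -> : Negz i - 1 = Negz i.+1 by lia.
    by rewrite /= -exprSr; apply: (deg_z (Negz i.+1)).
case: n => n.
  elim: n => [|n IHn]; first by rewrite addr0 mulr1; apply: deg_z.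
  by rewrite /= exprSr mulrA -addn1 PoszD addrA; apply: degx.
rewrite NegzE [zgen k e (- _)]/=; elim: n.+1 => {n}[|n IHn].
  by rewrite subr0 mulr1; apply: deg_z.
by rewrite exprSr mulrA -addn1 PoszD opprD addrA; apply: degy.
Qed.
End WeylTheory.

(** * The monomials [z^d] *)

Section ZPow.
Variables (k : fieldType) (E : choiceType).
Implicit Types (d : {malg int[E]}) (r : polyAlg k E).

Local Notation rho := (@urho k E).
Local Notation z d := (zpow k d : weyl k E).
Local Notation coef d := (fun e => d@_e).

Lemma zgen_coef_comm d e e' : GRing.comm (zgen k e d@_e) (zgen k e' d@_e').
Proof. by have [->|/zgen_comm] := eqVneq e e'. Qed.

Lemma zpowEw (s : {fset E}) d : (msupp d `<=` s)%fset ->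
  z d = \prod_(e <- s) zgen k e d@_e.
Proof.
move=> le; rewrite -[RHS](big_rmcond [in msupp d]); last first.
  by move=> e /mcoeff_outdom ->.
rewrite -[RHS]big_filter; apply: perm_prod_comm; first exact: zgen_coef_comm.
apply: uniq_perm; rewrite ?filter_uniq ?fset_uniq // => e.
by rewrite mem_filter; case: (boolP (e \in _)) => // /(fsubsetP le) ->.
Qed.

Lemma zpow0 : z 0 = 1.
Proof. by rewrite (@zpowEw fset0) ?msupp0 // big_seq_fset0. Qed.

Lemma zpowMEw (s : {fset E}) d d' :
  (msupp d `<=` s)%fset -> (msupp d' `<=` s)%fset ->
  z d * z d' = \prod_(e <- s) (zgen k e d@_e * zgen k e d'@_e).
Proof.
move=> le le'; rewrite (zpowEw le) (zpowEw le') prodrM_disjoint_comm //.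
by move=> e e'; apply: zgen_comm.
Qed.

Lemma has_shift_zpow d : has_shift (z d) (coef d).
Proof.
(* A partial product shifts only the variables listed in [s], each once since [s] is duplicate-free.
   Over the whole support this is the shift by [d]. *)
suff shift_prod (s : seq E) : uniq s ->
    has_shift (\prod_(e <- s) zgen k e d@_e)
      (fun e => if e \in s then d@_e else 0).
  apply: has_shift_eq (shift_prod _ (fset_uniq _)) => e.
  by case: ifPn => // /mcoeff_outdom ->.
elim: s => [_|e s IHs /= /andP[es us]].
  by rewrite big_nil; apply: has_shift1.
rewrite big_cons.
apply: has_shift_eq (has_shiftM (has_shift_zgen e _) (IHs us)) => e' /=.
rewrite inE /unit_deg; have [<-|_] := eqVneq e e'; last by rewrite add0r.
by rewrite (negbTE es) addr0.
Qed.

Lemma zpow_zpow d d' : exists r, z d * z d' = rho r * z (d + d').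
Proof.
pose s := (msupp d `|` msupp d')%fset.
rewrite (@zpowMEw s) ?fsubsetUl ?fsubsetUr // (@zpowEw s) ?msuppD_le //.
elim: (s : seq E) => [|e t [r IHt]].
  by exists 1; rewrite !big_nil rho1 mul1r.
rewrite !big_cons IHt; have [r' ->] := zgen_zgen k e d@_e d'@_e.
(* The polynomial from the remaining edges moves left past the monomial at [e]. *)
rewrite mcoeffD mulrA -[_ * _ * rho r]mulrA has_shift_zgen.
by eexists; rewrite !mulrA -rhoM.
Qed.

Lemma rho_prod (s : seq E) (F : E -> polyAlg k E) :
  rho (\prod_(e <- s) F e) = \prod_(e <- s) rho (F e).
Proof. exact: (big_morph rho (rhoM (k := k) (E := E)) (rho1 k E)). Qed.

Lemma zpowN_zpow d :
  z (- d) * z d = rho (\prod_(e <- msupp d) zfactor k e d@_e).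
Proof.
rewrite (@zpowMEw (msupp d)) ?msuppN // rho_prod.
by apply: eq_bigr => e _; rewrite mcoeffN zgenN_zgen.
Qed.

(** Applying [zpowN_zpow] to [- d] and shifting factor by factor yields the form required by the
    relation [X_i Y_i = sigma_i(t_i)]. *)
Lemma zpow_zpowN d :
  z d * z (- d)
  = rho (pshift k (coef d) (\prod_(e <- msupp d) zfactor k e d@_e)).
Proof.
rewrite -{1}[d]opprK zpowN_zpow msuppN rmorph_prod /=; congr rho.
by apply: eq_bigr => e _; rewrite mcoeffN zfactor_shift.
Qed.

(** Factors at distinct edges commute anyway, so the two products can be compared one edge at a
    time. *)
Lemma zpow_comm d d' :
  (forall e, GRing.comm (zgen k e d@_e) (zgen k e d'@_e)) ->
  GRing.comm (z d) (z d').
Proof.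
move=> dd'; pose s := (msupp d `|` msupp d')%fset.
rewrite /GRing.comm !(@zpowMEw s) ?fsubsetUl ?fsubsetUr //.
by apply: eq_bigr => e _; apply: dd'.
Qed.

Lemma weyl_star_zpow d : weyl_star (z d) = z (- d).
Proof.
have starP := weyl_starP k E.
have star_prod (s : seq E) (F : E -> weyl k E) :
    weyl_star (\prod_(e <- s) F e) = \prod_(e <- rev s) weyl_star (F e).
  elim: s => [|e s IHs]; first by rewrite !big_nil (involution1 starP).
  by rewrite big_cons (involutionM starP) IHs rev_cons big_rcons.
rewrite (@zpowEw (msupp d) (- d)) ?msuppN // /zpow star_prod.
under eq_bigr do rewrite weyl_star_zgen -mcoeffN.
apply: perm_prod_comm; first exact: zgen_coef_comm.
by rewrite perm_rev.
Qed.

Lemma rho_zpow_sq_eq0 r d :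
  rho r * z d * weyl_star (rho r * z d) = 0 -> r = 0.
Proof.
have [theta [theta_rho theta_x theta_y]] := weyl_action k E.
(* Acting injectively is stable under products, and the generators do so: [x_e] is an invertible
   shift, [y_e] a shift followed by multiplication by a variable. *)
pose inj (w : weyl k E) := forall f, theta w f = 0 -> f = 0.
have inj1 : inj 1 by move=> f; rewrite rmorph1.
have injM w w' : inj w -> inj w' -> inj (w * w').
  by move=> iw iw' f; rewrite rmorphM addEnd_mulE => /iw/iw'.
have injX w n : inj w -> inj (w ^+ n).
  by move=> iw; elim: n => [//|n IHn]; rewrite exprS; apply: injM.
have inj_zgen e n : inj (zgen k e n).
  case: n => n; apply: injX => f.
    by rewrite theta_x => /pshift_eq0.
  by rewrite theta_y -uvarE => /pvarM_eq0/pshift_eq0.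
have inj_zpow d' : inj (z d').
  rewrite /zpow; elim/big_rec: _ => // e w _ iw; exact: injM.
rewrite (involutionM (weyl_starP k E)) weyl_star_zpow -[in weyl_star _]urhoE.
rewrite weyl_rho_star urhoE mulrA -[_ * z d * _]mulrA zpow_zpowN -rhoM.
(* Since [z^d z^(-d)] lies in the commutative image of [rho], the left [rho r] passes to its right
   and joins the other one. *)
rewrite [r * _]mulrC rhoM -zpow_zpowN -mulrA -rhoM => zr0.
apply: polyAlg_reduced; apply: (injM _ _ (inj_zpow d) (inj_zpow (- d))).
(* Evaluation at the polynomial 1 recovers [r * r], which is then killed by an injective
   operator. *)
have -> : r * r = theta (rho (r * r)) 1 by rewrite theta_rho mulr1.
by rewrite -addEnd_mulE -rmorphM zr0 rmorph0.
Qed.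
End ZPow.

(** * The homomorphism *)

Section TGWInduction.
Variables (k : fieldType) (I : choiceType) (R : algType k).
Variables (D : tgwDatum I R) (mu : tgwMu k I).

Lemma tgwC_ind (P : tgwC D mu -> Prop) :
  (forall r, P (tgwC_rho D mu r)) ->
  (forall i, P (tgwC_X D mu i)) -> (forall i, P (tgwC_Y D mu i)) ->
  (forall a b, P a -> P b -> P (a + b)) -> (forall a, P a -> P (- a)) ->
  (forall a b, P a -> P b -> P (a * b)) -> forall a, P a.
Proof.
move=> Pr PX PY PD PN PM a; have [b ->] := qproj_surj a.
elim/freeRing_ind: b => [r|[]i|b c Pb Pc|b Pb|b c Pb Pc].
- exact: Pr.
- exact: PX.
- exact: PY.
- by rewrite rmorphD; apply: PD.
- by rewrite rmorphN; apply: PN.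
- by rewrite rmorphM; apply: PM.
Qed.

(** The algebra is generated by the image of [R] and the [X_i], [Y_i]; this gives the uniqueness of
    the map. *)
Lemma tgwA_ind (P : tgwA D mu -> Prop) :
  (forall r, P (tgwA_rho D mu r)) ->
  (forall i, P (tgwA_X D mu i)) -> (forall i, P (tgwA_Y D mu i)) ->
  (forall a b, P a -> P b -> P (a + b)) -> (forall a, P a -> P (- a)) ->
  (forall a b, P a -> P b -> P (a * b)) -> forall a, P a.
Proof.
move=> Pr PX PY PD PN PM a; have [b ->] := qproj_surj a.
elim/tgwC_ind: b => [r|i|i|b c Pb Pc|b Pb|b c Pb Pc].
- exact: Pr.
- exact: PX.
- exact: PY.
- by rewrite rmorphD; apply: PD.
- by rewrite rmorphN; apply: PN.
- by rewrite rmorphM; apply: PM.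
Qed.
End TGWInduction.

(** * The map on [tgwC] and its descent to [tgwA] *)

Section WeylMap.
Variables (k : fieldType) (V E : choiceType) (G : multiquiver V E).

Local Notation D := (mq_datum G k).
Local Notation mu := (mq_mu V k).
Local Notation z d := (zpow k d : weyl k E).
Local Notation col v := (incidence G << v >>).

(* An edge incident to both [i] and [j] has opposite signs in the two columns,
   so only powers of [x_e], or only powers of [y_e], meet. *)
Lemma zgen_coef_commN e i j : i != j ->
  GRing.comm (zgen k e (mq_coef G e i)) (zgen k e (- mq_coef G e j)).
Proof.
move=> ij; have [[n te]|nt] := pselect (exists n, mq_tgt G e = Some (i, n)).
  rewrite (mq_coef_tgt te) /mq_coef te /= (negbTE ij) sub0r opprK.
  exact: zgen_comm_pos.
have [[n se]|ns] := pselect (exists n, mq_src G e = Some (i, n)).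
  rewrite (mq_coef_src se) /mq_coef se /= (negbTE ij) subr0.
  exact: zgen_comm_neg.
rewrite mq_coef0 => [|n en|n en]; last 2 first.
- by apply: ns; exists n.
- by apply: nt; exists n.
exact/commr_sym/commr1.
Qed.

Definition weyl_map_gen (g : xyGen V) : weyl k E :=
  match g with
  | GX v => z (col v)
  | GY v => z (- col v)
  end.

Lemma mq_tE v : mq_t G k v = \prod_(e <- msupp (col v)) zfactor k e (col v)@_e.
Proof.
apply: eq_bigr => e _; rewrite incidenceE /mq_u.
by case: (mq_coef G e v) => n; apply: eq_bigr => j _; rewrite uvarE.
Qed.

Lemma mq_sigmaE v r :
  mq_sigma G k v r = pshift k (fun e => (col v)@_e) r.
Proof.
rewrite unlock; congr (polySubst _ r); apply/funext => e.
by rewrite incidenceE uvarE.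
Qed.

Lemma mq_sigmaVE v r :
  mq_sigmaV G v r = pshift k (fun e => (- col v)@_e) r.
Proof.
rewrite unlock; congr (polySubst _ r); apply/funext => e.
by rewrite mcoeffN incidenceE uvarE mulrNz opprK.
Qed.

Lemma weyl_map_rel a b : tgw_rel D mu a b ->
  flift (@weyl_rho k E) weyl_map_gen a = flift (@weyl_rho k E) weyl_map_gen b.
Proof.
case=> [i r|i r|i|i|i j ij];
  rewrite !rmorphM /= ?flift_scal !flift_gen /= !urhoE.
- by rewrite has_shift_zpow mq_sigmaE.
- by rewrite has_shift_zpow mq_sigmaVE.
- by rewrite zpowN_zpow mq_tE.
- by rewrite zpow_zpowN mq_sigmaE mq_tE.
(* As [mu] is constantly 1, this relation says that [z^(gamma i)] and [z^(- gamma j)] commute. *)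
- rewrite scale1r rho1 mul1r; apply: zpow_comm => e.
  by rewrite mcoeffN !incidenceE; apply: zgen_coef_commN.
Qed.

Lemma weyl_map_tgwC : exists f : {rmorphism tgwC D mu -> weyl k E},
  [/\ forall r, f (tgwC_rho D mu r) = weyl_rho r,
      forall v, f (tgwC_X D mu v) = z (col v)
    & forall v, f (tgwC_Y D mu v) = z (- col v)].
Proof.
have [f fE] := quotRing_lift (rel_ideal_ker weyl_map_rel).
exists f; split=> [r|v|v]; rewrite fE /=.
- exact: flift_scal.
- exact: flift_gen.
- exact: flift_gen.
Qed.

Section Lift.
Variable f : {rmorphism tgwC D mu -> weyl k E}.
Hypothesis f_rho : forall r, f (tgwC_rho D mu r) = weyl_rho r.
Hypothesis f_X : forall v, f (tgwC_X D mu v) = z (col v).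
Hypothesis f_Y : forall v, f (tgwC_Y D mu v) = z (- col v).

Let CstarP := tgwC_starP D (mq_muC (V := V) k).
Let WstarP := weyl_starP k E.

(** Both sides are additive and reverse products, so generators suffice. This serves both to compute
    the image of [b b^*] and to make the final map respect the involutions. *)
Lemma weyl_map_star a : f (tgwC_star a) = weyl_star (f a).
Proof.
elim/tgwC_ind: a => [r|v|v|a b IHa IHb|a IHa|a b IHa IHb].
- by rewrite (tgwC_star_rho D (mq_muC (V := V) k)) f_rho weyl_rho_star.
- by rewrite (tgwC_star_X D (mq_muC (V := V) k)) f_Y f_X weyl_star_zpow.
- rewrite (tgwC_star_Y D (mq_muC (V := V) k)) f_Y f_X weyl_star_zpow.
  by rewrite opprK.
- by rewrite (involutionD CstarP) !rmorphD (involutionD WstarP) IHa IHb.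
- by rewrite (involutionN CstarP) !rmorphN (involutionN WstarP) IHa.
- by rewrite (involutionM CstarP) !rmorphM (involutionM WstarP) IHa IHb.
Qed.

Lemma weyl_map_homog d a : tgw_homog d a ->
  exists r, f a = urho r * z (incidence G d).
Proof.
elim=> {d a} [r|v|v|d|d a b _ [p IHa] _ [q IHb]|d d' a b _ [p IHa] _ [q IHb]].
- by exists r; rewrite f_rho raddf0 zpow0 mulr1 urhoE.
- by exists 1; rewrite f_X rho1 mul1r.
- by exists 1; rewrite f_Y rho1 mul1r raddfN.
- by exists 0; rewrite rmorph0 -urhoE rmorph0 mul0r.
- by exists (p + q); rewrite rmorphD IHa IHb rhoD mulrDl.
- have [r zz] := zpow_zpow k (incidence G d) (incidence G d').
  (* The inner polynomial [q] moves left through the first monomial; then the two monomials merge by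
     [zz]. *)
  rewrite rmorphM IHa IHb raddfD mulrA -[_ * z _ * _]mulrA has_shift_zpow.
  rewrite mulrA -[_ * z (incidence G d')]mulrA zz mulrA -!rhoM.
  by eexists.
Qed.

(* A homogeneous [a] in [K] has [a a^* = 0], as this lies in [K] and in degree
   zero. *)
Lemma weyl_map_rad a : tgw_rad D mu a -> f a = 0.
Proof.
elim=> {a} [K a gK tK Ka||a b _ fa _ fb]; last 2 first.
- exact: rmorph0.
- by rewrite rmorphD fa fb addr0.
(* Gradedness reduces the claim to homogeneous elements of [K]. *)
have [s [sP ->]] := gK a Ka.
rewrite rmorph_sum big_seq big1 // => b /sP[Kb [d hb]].
have bb0 : b * tgwC_star b = 0.
  apply: tK; first exact: Defs.idealMr.
  rewrite -(subrr d); apply: th_mul => //.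
  exact: (tgw_homog_star (mq_muC (V := V) k)).
have [r fb] := weyl_map_homog hb.
have : f (b * tgwC_star b) = 0 by rewrite bb0 rmorph0.
rewrite rmorphM weyl_map_star fb => /rho_zpow_sq_eq0 ->.
by rewrite -urhoE rmorph0 mul0r.
Qed.
End Lift.
End WeylMap.

Theorem theorem4p1 (k : fieldType) (hk : [pchar k] =i pred0)
    (V E : choiceType) (G : multiquiver V E) :
  exists! phi : mqAlg G k -> weylAlg k E,
    [/\ invRing_map phi,
        forall v : V, phi (mqX G k v) = zpow k (incidence G << v >>),
        forall v : V, phi (mqY G k v) = zpow k (- incidence G << v >>)
      & forall e : E,
          phi (ir_rho (mqAlg G k) (pvar k e)) = weyl_y k e * weyl_x k e].
Proof.
have [f [f_rho f_X f_Y]] := weyl_map_tgwC k G.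
have [phi phiE] := quotRing_lift (weyl_map_rad f_rho f_X f_Y).
exists phi; split.
  split=> [|v|v|e].
  - split=> [x y||r|a].
    + exact: rmorphB.
    + by split; [apply: rmorph1|apply: rmorphM].
    + by rewrite [LHS]phiE f_rho.
    + have [b ->] := qproj_surj a.
      rewrite [ir_star _](tgwA_star_proj (mq_muC (V := V) k)) !phiE.
      exact: weyl_map_star.
  - by rewrite [LHS]phiE f_X.
  - by rewrite [LHS]phiE f_Y.
  - by rewrite [LHS]phiE f_rho; apply: polyEval_var.
move=> psi [[psiB [psi1 psiM] psi_rho _] psi_X psi_Y _]; apply/funext.
(* A competing map is only known to preserve differences; the induction on generators also asks for
   opposites and sums. *)
have psi0 : psi 0 = 0 by rewrite -[in LHS](subrr 0) psiB subrr.
have psiN a : psi (- a) = - psi a by rewrite -sub0r psiB psi0 sub0r.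
have psiD a b : psi (a + b) = psi a + psi b.
  by rewrite -[in LHS](opprK b) psiB psiN opprK.
apply: tgwA_ind => [r|v|v|a b IHa IHb|a IHa|a b IHa IHb].
- by rewrite [RHS]psi_rho [LHS]phiE f_rho.
- by rewrite [RHS]psi_X [LHS]phiE f_X.
- by rewrite [RHS]psi_Y [LHS]phiE f_Y.
- by rewrite [LHS]rmorphD [RHS]psiD IHa IHb.
- by rewrite [LHS]rmorphN [RHS]psiN IHa.
- by rewrite [LHS]rmorphM [RHS]psiM IHa IHb.
Qed.
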